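(* Let $f=P_\alpha$ be monic of degree $n\ge2$ with simple real roots, and let $q=P_\beta$ be monic and real-rooted of the same degree. Write $\gamma=\Omega(\alpha,\beta)$. For every real $p>1$, $\|s(\gamma)\|_p\le\|s(\alpha)\|_p$, with equality if and only if $q$ is a point mass.
   Context: Finite free additive convolution: for $p(x)=\sum_{k=0}^n(-1)^ka_kx^{n-k}$ and $q(x)=\sum_{k=0}^n(-1)^kb_kx^{n-k}$ with $a_0=b_0=1$, set $(p\boxplus_n q)(x)=\sum_{k=0}^n(-1)^kc_kx^{n-k}$ with $c_k=\sum_{i+j=k}\frac{(n-i)!(n-j)!}{n!(n-k)!}a_ib_j$; it preserves real-rootedness (Walsh), and the output has simple roots if one of two real-rooted inputs does (Fujie). $P_\alpha(x)=\prod_{i=1}^n(x-\alpha_i)$. $\Omega(\alpha,\beta)\in\mathbb R^n$ is the vector of roots of $P_\alpha\boxplus_nP_\beta$ in increasing order. For a vector $\rho$ with distinct real coordinates the score is $s(\rho)_i=\sum_{j\ne i}\frac1{\rho_i-\rho_j}$. $\|\cdot\|_p$ is the usual $\ell^p$ norm on $\mathbb R^n$. A point mass is a polynomial of the form $(x-b)^n$, $b\in\mathbb R$. *)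

(* Defs.v *)
From HB Require Import structures.
From mathcomp Require Import all_boot all_order all_algebra.
From mathcomp Require Import all_classical all_reals all_analysis.

Set Implicit Arguments.
Unset Strict Implicit.
Unset Printing Implicit Defensive.
Import Order.TTheory GRing.Theory Num.Theory.
Local Open Scope classical_set_scope.
Local Open Scope ring_scope.

(* In degree n, p = \sum_k (-1)^k a_k x^(n-k) with a_k = sgcoef n p k. *)
Definition sgcoef (R : realType) (n : nat) (p : {poly R}) (k : nat) : R :=
  (-1) ^+ k * p`_(n - k).

Definition ffconv_coef (R : realType) (n : nat) (p q : {poly R}) (k : nat) : R :=
  \sum_(i < k.+1)
    ((n - i)`! * (n - (k - i))`!)%:R / (n`! * (n - k)`!)%:R
    * (sgcoef n p i * sgcoef n q (k - i)).

Definition ffconv (R : realType) (n : nat) (p q : {poly R}) : {poly R} :=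
  \sum_(k < n.+1) ((-1) ^+ k * ffconv_coef n p q k) *: 'X^(n - k).

Definition rootpoly (R : realType) (n : nat) (a : 'rV[R]_n) : {poly R} :=
  \prod_(i < n) ('X - (a 0 i)%:P).

Definition nondecreasing_vec (R : realType) (n : nat) (g : 'rV[R]_n) : Prop :=
  forall i j : 'I_n, (i <= j)%N -> g 0 i <= g 0 j.

(* The roots counted with multiplicity; the default value 0 is only reached
   when p is not monic and real-rooted of degree n. *)
Definition ordered_roots (R : realType) (n : nat) (p : {poly R}) : 'rV[R]_n :=
  xget 0 [set g : 'rV[R]_n | nondecreasing_vec g /\ rootpoly g = p].

Definition Omega (R : realType) (n : nat) (a b : 'rV[R]_n) : 'rV[R]_n :=
  ordered_roots n (ffconv n (rootpoly a) (rootpoly b)).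

Definition score (R : realType) (n : nat) (r : 'rV[R]_n) : 'rV[R]_n :=
  \row_(i < n) \sum_(j < n | j != i) (r 0 i - r 0 j)^-1.

Definition lpnorm (R : realType) (n : nat) (p : R) (v : 'rV[R]_n) : R :=
  (\sum_(i < n) `|v 0 i| `^ p) `^ p^-1.

Definition point_mass (R : realType) (n : nat) (q : {poly R}) : Prop :=
  exists b : R, q = ('X - b%:P) ^+ n.

Lemma ordered_rootsE (R : realType) (n : nat) (g : 'rV[R]_n) :
  nondecreasing_vec g -> ordered_roots n (rootpoly g) = g.
Proof.
have to_seq (h : 'rV[R]_n) :
    rootpoly h = \prod_(x <- [seq h 0 i | i <- enum 'I_n]) ('X - x%:P).
  by rewrite big_map /rootpoly big_enum.
have sorted_seq (h : 'rV[R]_n) : nondecreasing_vec h ->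
    sorted <=%O [seq h 0 i | i <- enum 'I_n].
  move=> hh; rewrite sorted_map.
  apply: (@sub_sorted _ (relpre val leq)); first by move=> i j /= /hh.
  by rewrite -sorted_map val_enum_ord iota_sorted.
move=> gs; apply: xget_unique => // h [hs hg].
have E :
    [seq h 0 i | i <- enum 'I_n] = [seq g 0 i | i <- enum 'I_n].
  apply: le_sorted_eq; rewrite ?sorted_seq //.
  by apply: prod_XsubC_eq; rewrite -!to_seq.
apply/rowP => i; have /eq_in_map/(_ i) := E; apply.
by rewrite mem_enum.
Qed.

(* Main.v *)
(* Let T be the operator [f |-> f boxplus_n P_beta], f_i = f / (x - alpha_i) and
   r = T f = P_gamma. The Jacobian J_ji = (T f_i)(gamma_j) / r'(gamma_j) of the
   roots is doubly stochastic: rows because T commutes with differentiation and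
   f' = \sum_i f_i, columns by Lagrange interpolation. Since
   f'' = 2 \sum_i s(alpha)_i f_i, also s(gamma) = J s(alpha), and the inequality
   is Jensen's for |x|^p.
   Nonnegativity of J and simplicity of r both come from the fact that T preserves
   real-rooted forms with distinct projective zeros. This is proved by induction on
   the factors of P_beta: such a pencil of forms is characterized by a Wronskian
   without zeros, and peeling off x - b gives
   n T f = (x - b) T' f' + T' (n f - x f') with T' the operator in degree n - 1.
   In the equality case, if the row j of J has only positive entries then s(alpha)
   is constant, which is absurd. This happens as soon as gamma_j - b is not a root
   of f, where b is a root of P_beta; if it failed for all j then gamma - b would
   permute alpha, and b would be the mean of beta. *)

From HB Require Import structures.
Require Import Defs.
From mathcomp Require Import all_boot all_order all_algebra.
From mathcomp Require Import all_classical all_reals all_analysis.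
From mathcomp Require Import polyrcf polyorder ring lra.
Import Order.TTheory GRing.Theory Num.Theory.
Local Open Scope ring_scope.

(** * Wronskians and interlacing *)

Section Interlacing.
Set Implicit Arguments.
Unset Strict Implicit.
Variable R : realType.
Implicit Types (u v w p q f g h : {poly R}) (x y z : R).

Definition wronskian u v : {poly R} := u^`() * v - u * v^`().

(* The coefficient of ['X^(2m - 2)] in [wronskian u v] for [u], [v] of degree at
   most [m]: the value at infinity of the Wronskian of two forms of degree [m]. *)
Definition wronskian_infty (m : nat) u v : R :=
  u`_m * v`_m.-1 - u`_m.-1 * v`_m.

(* Binary forms of degree [m] with [m] distinct zeros on the real projective
   line: a polynomial of degree [m - 1] has its last zero at infinity. *)
Definition simple_real (m : nat) p : Prop :=
  (m <= size p <= m.+1)%N /\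
  exists s : seq R, [/\ uniq s, all (root p) s & size p = (size s).+1].

Lemma horner_wronskian u v x :
  (wronskian u v).[x] = u^`().[x] * v.[x] - u.[x] * v^`().[x].
Proof. by rewrite /wronskian !hornerE. Qed.

Lemma root_gt_of_lead p y : p.[y] * lead_coef p < 0 -> exists2 z, y < z & root p z.
Proof.
wlog lp : p / 0 < lead_coef p => [H hp|].
  have [l0|l0|l0] := ltrgt0P (lead_coef p); first exact: H.
    have [||z yz] := H (- p); rewrite ?lead_coefN ?hornerN ?oppr_gt0 ?mulrNN //.
    by rewrite rootN => rz; exists z.
  by rewrite l0 mulr0 ltxx in hp.
(* Near plus infinity [p] has the sign of its leading coefficient, so the intermediate value theorem
   applies on the right of [y]. *)
rewrite pmulr_llt0 // => py.
have [b hb] := poly_pinfty_gt_lc lp.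
have yb : y <= Num.max b y by rewrite le_max lexx orbT.
have pb : 0 < p.[Num.max b y].
  by apply: (lt_le_trans lp); apply: hb; rewrite le_max lexx.
have pp : p.[y] * p.[Num.max b y] < 0 by rewrite pmulr_llt0.
have [z] := poly_ivtoo yb pp.
by rewrite in_itv /= => /andP[yz _] rz; exists z.
Qed.

Lemma is_derive_horner p x : is_derive x 1 (horner p) p^`().[x].
Proof.
apply: DeriveDef; first exact: derivable_horner.
by rewrite derivE derive1E.
Qed.

(* Rolle's theorem for [u / v], whose derivative has the sign of the Wronskian. *)
Lemma wronskian_root_between u v y z :
    (forall x, (wronskian u v).[x] != 0) -> y < z -> root u y -> root u z ->
  exists2 t, y < t < z & root v t.
Proof.
move=> W yz /rootP uy /rootP uz.
have vN x : root u x -> v.[x] != 0.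
  by move=> /rootP ux; have := W x; rewrite horner_wronskian ux mul0r subr0 mulf_eq0 => /norP[].
apply: contrapT => nr.
have v0 x : x \in `[y, z] -> v.[x] != 0.
  rewrite in_itv /= !le_eqVlt => /andP[/predU1P[<-|yx] /predU1P[->|xz]];
    try by apply/vN/rootP.
  by apply/negP => vx; apply: nr; exists x; rewrite ?yx.
pose F x := u.[x] * (v.[x])^-1.
have dF x : x \in `[y, z] -> is_derive x 1 F ((wronskian u v).[x] / v.[x] ^+ 2).
  move=> /v0 vx.
  have := is_derive_horner u x; have := is_derive_horner v x => dv du.
  have dV := is_deriveV vx dv.
  have := is_deriveM du dV.
  move=> /is_derive_eq; apply.
  rewrite horner_wronskian /GRing.scale /= ; field.
  by [].
have dF' x : x \in `[y, z] -> derivable F x 1 by move=> /dF /@ex_derive.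
have Fyz : F y = F z by rewrite /F uy uz !mul0r.
have Fc := derivable_within_continuous dF'.
have [x xyz] := Rolle yz (fun x xi => dF' x (subset_itv_oo_cc xi)) Fc Fyz.
move=> /@derive_val d0; have /@derive_val := dF x (subset_itv_oo_cc xyz).
rewrite d0 => /esym/eqP; rewrite mulf_eq0 (negPf (W x)) invr_eq0 expf_eq0 /=.
by rewrite (negPf (v0 _ (subset_itv_oo_cc xyz))).
Qed.

Lemma poly_size2E p : (size p <= 2)%N -> p = p`_1 *: 'X + (p`_0)%:P.
Proof.
move=> sp; apply/polyP => -[|[|i]]; rewrite !coefE ?mulr0 ?add0r ?mulr1 ?addr0 //.
by apply: nth_default; apply: leq_trans sp _.
Qed.

Lemma mem_sorted_last y0 ys y : path <%R y0 ys -> y \in y0 :: ys -> y <= last y0 ys.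
Proof.
elim: ys y0 y => [|y1 ys IH] y0 y /=; first by rewrite inE => _ /eqP->.
move=> /andP[y01 pys]; rewrite in_cons => /predU1P[->|yi]; last exact: IH yi.
by apply: (le_trans (ltW y01)); apply: IH pys (mem_head _ _).
Qed.

(** One point of [P] is picked in each gap of the sorted list. The picked points increase and stay
    below the last entry, so they are distinct and a further point beyond that entry can still be
    added. *)
Lemma path_interlace (P : pred R) y0 ys :
    path <%R y0 ys ->
    (forall y z, y \in y0 :: ys -> z \in y0 :: ys -> y < z ->
       exists2 t, y < t < z & P t) ->
  exists zs, [/\ path <%R y0 zs, all P zs, size zs = size ys
              & all (fun z => z < last y0 ys) zs].
Proof.
elim: ys y0 => [|y1 ys IH] y0 /=; first by exists [::].
move=> /andP[y01 pys] H.
have [|zs [pz az sz lz]] := IH y1 pys.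
  by move=> y z yi zi; apply: H; rewrite inE ?yi ?zi orbT.
have [||t /andP[y0t ty1] Pt] := H y0 y1 _ _ y01; rewrite ?inE ?eqxx ?orbT //.
exists (t :: zs); split => /=; rewrite ?y0t ?Pt ?sz ?lz ?andbT //.
- by case: zs pz {az sz lz} => //= z zs /andP[y1z ->]; rewrite (lt_trans ty1).
- by apply: (lt_le_trans ty1); apply: mem_sorted_last pys (mem_head _ _).
Qed.

Lemma simple_real_neq0 m p : simple_real m p -> p != 0.
Proof. by move=> [_ [s [_ _ sp]]]; rewrite -size_poly_eq0 sp. Qed.

Lemma simple_real_factor m p x : simple_real m.+1 p -> root p x ->
  exists h, [/\ p = ('X - x%:P) * h, simple_real m h & h.[x] != 0].
Proof.
move=> [szp [s [us rs sp]]] rx.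
have xs : x \in s.
  apply: contraT => xs; have p0 : p != 0 by rewrite -size_poly_eq0 sp.
  by have := max_poly_roots p0 (_ : all (root p) (x :: s)) (_ : uniq (x :: s));
    rewrite /= rx rs us xs sp ltnn => /(_ isT isT).
have us' := us; rewrite -uniq_rootsE in us.
have pE := all_roots_prod_XsubC sp rs us.
rewrite (perm_big _ (perm_to_rem xs)) big_cons /= in pE.
set q := \prod_(_ <- _) _ in pE.
have lp0 : lead_coef p != 0 by rewrite lead_coef_eq0 -size_poly_eq0 sp.
exists (lead_coef p *: q); rewrite -scalerAr; split => //.
- split.
    rewrite size_scale // size_prod_XsubC size_rem //.
    by move: szp; rewrite sp; case: (s) xs.
  exists (rem x s); split; first exact: rem_uniq.
    by apply/allP => y ys; rewrite rootZ // root_prod_XsubC.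
  by rewrite size_scale // size_prod_XsubC.
- by rewrite hornerZ mulf_neq0 // -/(root q x) root_prod_XsubC mem_rem_uniqF.
Qed.

Lemma simple_real_deriv m p x : simple_real m p -> root p x -> p^`().[x] != 0.
Proof.
move=> Fp rx; have Fp' : simple_real m.-1.+1 p \/ m = 0%N.
  by case: m Fp => [|m] Fp; [right|left].
case: Fp' => [/simple_real_factor/(_ rx)[h [-> _ hx]]|m0].
  by rewrite derivM derivXsubC !hornerE subrr mul0r addr0.
move: Fp; rewrite {}m0 => -[/= /size1_polyC pE [s [_ _]]].
move: rx; rewrite pE rootC => /eqP ->.
by rewrite size_poly0.
Qed.

(* A negative Wronskian on the whole projective line, the point at infinity
   included, makes [u] and [v] interlace strictly. *)
Lemma simple_real_wronskian m u v :
    simple_real m.+1 u -> (size v <= m.+2)%N ->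
    (forall x, (wronskian u v).[x] < 0) -> wronskian_infty m.+1 u v < 0 ->
  simple_real m.+1 v.
Proof.
move=> Fu sv W Wi; have [/andP[su su'] [s0 [us0 rs0 sus0]]] := Fu.
have W0 x : (wronskian u v).[x] != 0 by rewrite lt_eqF.
have v_simple x : root v x -> v^`().[x] != 0.
  move=> /rootP vx; apply/eqP => dvx; have := W x.
  by rewrite horner_wronskian vx dvx !mulr0 subrr ltxx.
have [s [ss us rs sus]] : exists s, [/\ sorted <%R s, uniq s, all (root u) s & size u = (size s).+1].
  exists (sort <=%O s0); rewrite sort_uniq size_sort all_sort us0 rs0; split=> //.
  by rewrite sort_lt_sorted.
have [zs [uzs rzs szs]] : exists zs, [/\ uniq zs, all (root v) zs & size zs = m].
  have btw y0 ys : s = y0 :: ys -> exists zs, [/\ path <%R y0 zs, all (root v) zs, size zs = size ys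
              & all (fun z => z < last y0 ys) zs].
    move=> sE; apply: path_interlace; first by rewrite sE in ss.
    rewrite -sE => y z ys' zs yz.
    by apply: (wronskian_root_between W0 yz); apply: (allP rs).
  have uniq_path y0 zs : path <%R y0 zs -> uniq zs.
    by move=> /path_sorted; apply: sorted_uniq; [exact: lt_trans|exact: ltxx].
  case: s ss us rs sus btw => [|y0 ys] ss us rs sus btw.
    by exists [::]; move: su; rewrite sus /=; case: (m).
  have [zs [pz az sz lz]] := btw _ _ erefl.
  move: su'; rewrite leq_eqVlt => /orP[/eqP su2|su2].
    exists zs; split=> //; first exact: uniq_path pz.
    by move: su2; rewrite sus /= sz => -[].
  (* Here [u] has a zero at infinity: the gaps between its roots give only m - 1 zeros of [v], and
     the missing one lies beyond the last root [y]. *)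
  have {su su2} suE : size u = m.+1 by apply/eqP; rewrite eqn_leq su andbT.
  set y := last y0 ys.
  have ry : root u y by apply: (allP rs); rewrite mem_last.
  have [h [uE _ hy]] := simple_real_factor Fu ry.
  have h0 : h != 0 by apply: contraNneq hy => ->; rewrite horner0.
  have ulead : u`_m = lead_coef u by rewrite /lead_coef suE.
  have hlead : lead_coef h = u`_m.
    by rewrite ulead uE lead_coefM lead_coefXsubC mul1r.
  have um1 : u`_m.+1 = 0 by apply: nth_default; rewrite suE.
  have uv : 0 < u`_m * v`_m.+1.
    by move: Wi; rewrite /wronskian_infty um1 mul0r sub0r oppr_lt0.
  have vlead : lead_coef v = v`_m.+1.
    rewrite /lead_coef; suff -> : size v = m.+2 by [].
    apply/eqP; rewrite eqn_leq sv ltnNge; apply/negP => /leq_sizeP/(_ _ (leqnn _)) v0.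
    by rewrite v0 mulr0 ltxx in uv.
  (* The quotient [h] has no root beyond [y], so [h.[y]] has the sign of its leading coefficient.
     The signs of the Wronskian at [y] and at infinity then force [v] to change sign after [y]. *)
  have hu : 0 < h.[y] * u`_m.
    rewrite ltNge; apply/negP; rewrite le_eqVlt mulf_eq0 (negPf hy) /=.
    have -> /= : (u`_m == 0) = false.
      by apply/negbTE; apply: contraTneq uv => ->; rewrite mul0r ltxx.
    rewrite -hlead => /root_gt_of_lead[z yz rz].
    have rz' : root u z by rewrite uE rootM rz orbT.
    have : z \in y0 :: ys.
      apply: contraT => zs'; have u0 := simple_real_neq0 Fu.
      have az' : all (root u) (z :: y0 :: ys) by apply/andP.
      have uz : uniq (z :: y0 :: ys) by apply/andP.
      by have := max_poly_roots u0 az' uz; rewrite sus /= ltnn.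
    by move=> /(mem_sorted_last ss); rewrite leNgt yz.
  have hv : h.[y] * v.[y] < 0.
    have := W y; rewrite horner_wronskian (rootP ry) mul0r subr0.
    by rewrite uE derivM derivXsubC !hornerE subrr mul0r addr0.
  have vv : v.[y] * lead_coef v < 0.
    rewrite vlead.
    have : 0 < (h.[y] * u`_m) * (u`_m * v`_m.+1) by rewrite mulr_gt0.
    have -> : (h.[y] * u`_m) * (u`_m * v`_m.+1) = u`_m ^+ 2 * (h.[y] * v`_m.+1) by ring.
    have u2 : 0 < u`_m ^+ 2 by rewrite exprn_even_gt0 //=; apply: contraTneq uv => ->; rewrite mul0r ltxx.
    rewrite pmulr_rgt0 // => hv'.
    have := mulr_gt0 hv' (_ : 0 < - (h.[y] * v.[y])); rewrite oppr_gt0 => /(_ hv).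
    have -> : h.[y] * v`_m.+1 * - (h.[y] * v.[y]) = h.[y] ^+ 2 * - (v.[y] * v`_m.+1) by ring.
    by rewrite pmulr_rgt0 ?oppr_gt0 // exprn_even_gt0.
  have [z yz rz] := root_gt_of_lead vv.
  exists (z :: zs); split; rewrite /= ?rz //.
    rewrite (uniq_path _ _ pz) andbT; apply/negP => /(allP lz).
    by rewrite ltNge (ltW yz).
  by move: suE; rewrite sus /= sz => -[].
have v0 : v != 0.
  by apply: contraTneq Wi => ->; rewrite /wronskian_infty !coef0 !mulr0 subrr ltxx.
(* With m distinct roots split off, the quotient [q] has degree at most 1. A linear [q] supplies the
   last root, which is new because the Wronskian makes all roots of [v] simple. *)
have [q vE] := uniq_roots_prod_XsubC rzs (introT idP (etrans (uniq_rootsE _) uzs)).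
have q0 : q != 0 by apply: contraNneq v0 => q0; rewrite vE q0 mul0r.
have svE : size v = (size q + m)%N.
  by rewrite vE (size_Mmonic q0 (monic_prod_XsubC _ _ _)) size_prod_XsubC szs addnS.
have sq : (size q <= 2)%N by move: sv; rewrite svE -add2n leq_add2r.
have sq0 : (0 < size q)%N by rewrite lt0n size_poly_eq0.
split; first by rewrite svE -add1n -add2n !leq_add2r sq0.
have [q1|q2] : size q = 1%N \/ size q = 2%N.
  by case: (size q) sq sq0 => [|[|[]]] // _ _; [left|right].
  by exists zs; rewrite svE q1 szs.
have [z rz] : exists z, root q z.
  have q10 : q`_1 != 0 by rewrite -[1%N]/(2.-1) -q2 -/(lead_coef q) lead_coef_eq0.
  exists (- q`_0 / q`_1); rewrite /root.
  rewrite (poly_size2E sq) !hornerE !coefE /= mulr0 mulr1 add0r addr0; apply/eqP; field; exact: q10.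
exists (z :: zs); split; rewrite /= ?svE ?q2 ?szs //.
- rewrite uzs andbT; apply/negP => zzs.
  have := v_simple z (_ : root v z); rewrite (allP rzs) // => /(_ isT).
  rewrite vE derivM hornerD !hornerM (rootP rz) mul0r addr0.
  have /rootP -> : root (\prod_(t <- zs) ('X - t%:P)) z by rewrite root_prod_XsubC.
  by rewrite mulr0 eqxx.
- by rewrite rzs andbT vE rootM rz.
Qed.

Lemma simple_realZ m c p : c != 0 -> simple_real m p -> simple_real m (c *: p).
Proof.
move=> c0 [sp [s [us rs sE]]]; split; first by rewrite size_scale.
by exists s; rewrite size_scale //; split=> //; apply/allP => y ys; rewrite rootZ // (allP rs).
Qed.

Lemma simple_real_level k m p : (m <= size p <= m.+1)%N -> simple_real k p -> simple_real m p.
Proof. by move=> sp [_ H]. Qed.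

Lemma simple_real_linear p : (0 < size p <= 2)%N -> simple_real 1 p.
Proof.
move=> /andP[p0 p2]; split; first by rewrite p0.
have [p1|pS] := leqP (size p) 1.
  by exists [::]; split=> //; apply/eqP; rewrite eqn_leq p1.
have sp : size p = 2%N by apply/eqP; rewrite eqn_leq p2.
have p10 : p`_1 != 0 by rewrite -[1%N]/(2.-1) -sp -/(lead_coef p) lead_coef_eq0 -size_poly_eq0 sp.
exists [:: - p`_0 / p`_1]; split=> //=; rewrite andbT /root.
rewrite (poly_size2E p2) !hornerE !coefE /= mulr0 mulr1 add0r addr0; apply/eqP; field; exact: p10.
Qed.

(** * Laguerre's and Newton's inequalities *)

Lemma deriv2_mulXsubC a h :
  (('X - a%:P) * h)^`()^`() = 2 *: h^`() + ('X - a%:P) * h^`()^`().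
Proof.
rewrite derivM derivXsubC mul1r derivD derivM derivXsubC mul1r.
by rewrite scaler_nat mulr2n addrA.
Qed.

Lemma has_root_simple_real k f : simple_real k.+2 f -> exists a, root f a.
Proof. by move=> [/andP[sf _] [[|a s] [_ /= rs sE]]]; [rewrite sE in sf|exists a; case/andP: rs]. Qed.

(** Induction on the degree by splitting off a root [a]. In degree 2 the difference of the two sides
    is the discriminant, the square of [h.[a]]. *)
Lemma laguerre k f x : simple_real k.+2 f ->
  k.+2%:R * (f.[x] * f^`()^`().[x]) < k.+1%:R * f^`().[x] ^+ 2.
Proof.
elim: k f => [|k IH] f Ff; have [a ra] := has_root_simple_real Ff;
  have [h [-> Fh ha]] := simple_real_factor Ff ra; rewrite deriv2_mulXsubC derivM derivXsubC
    !(hornerXsubC, hornerM, hornerD, hornerZ, hornerC) mul1r.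
  have [/andP[h0 h2] _] := Fh.
  have hE := poly_size2E h2.
  have dh : h^`() = (h`_1)%:P by rewrite hE derivD derivZ derivX derivC addr0 !coefE /= mulr1 addr0 alg_polyC.
  have hx z : h.[z] = h`_1 * z + h`_0 by rewrite {1}hE !hornerE.
  move: ha; rewrite dh derivC hornerC horner0 !hx mulr0 addr0 => ha.
  have : 0 < (h`_1 * a + h`_0) ^+ 2 by rewrite exprn_even_gt0.
  set c := h`_1; set d := h`_0 => cd.
  rewrite -subr_gt0; apply: (lt_le_trans cd); rewrite le_eqVlt; apply/orP; left; apply/eqP.
  ring.
have := IH _ Fh.
set A := h.[x]; set B := h^`().[x]; set C := h^`()^`().[x]; set y := x - a.
rewrite -![_.+3%:R]natr1 -![_.+2%:R]natr1; set K := k.+1%:R.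
have K0 : 0 < K by rewrite ltr0n.
move=> D; rewrite -subr_gt0 -(pmulr_rgt0 _ (_ : 0 < K + 1)) ?addr_gt0 //.
(* The first summand is positive by induction unless y = 0. In that case the square is positive,
   because [h] does not vanish at [a]. *)
have -> : (K + 1) * ((K + 1) * (A + y * B) ^+ 2 - (K + 1 + 1) * (y * A * (2 * B + y * C)))
  = (K + 2) * (y ^+ 2 * (K * B ^+ 2 - (K + 1) * (A * C))) + (y * B - (K + 1) * A) ^+ 2 by ring.
have [y0|y0] := eqVneq y 0.
  rewrite y0 expr0n /= !mul0r mulr0 sub0r add0r exprn_even_gt0 //= oppr_eq0 mulf_neq0 //.
    by rewrite gt_eqF // addr_gt0.
  by have -> : A = h.[a] by rewrite /A -[x](subrK a) -/y y0 add0r.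
rewrite ltr_wpDr ?sqr_ge0 // mulr_gt0 ?addr_gt0 //.
by rewrite mulr_gt0 ?exprn_even_gt0 // subr_gt0.
Qed.

(** This is Laguerre's inequality at infinity: the difference of the two sides of [laguerre] has
    degree at most 2k, and its coefficient there is the difference of the two sides here. The
    induction is the same. *)
Lemma newton k f : simple_real k.+2 f ->
  2 * k.+2%:R * (f`_k.+2 * f`_k) < k.+1%:R * f`_k.+1 ^+ 2.
Proof.
elim: k f => [|k IH] f Ff; have [a ra] := has_root_simple_real Ff;
  have [h [-> Fh ha]] := simple_real_factor Ff ra;
  have [/andP[h0 hs] _] := Fh; have hz := nth_default 0 hs;
  rewrite mulrBl !coefB !coefXM !coefCM /= hz mulr0 subr0.
  have hE := poly_size2E hs.
  have ha' : h.[a] = h`_1 * a + h`_0 by rewrite {1}hE !hornerE.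
  rewrite ha' in ha.
  have : 0 < (h`_1 * a + h`_0) ^+ 2 by rewrite exprn_even_gt0.
  move=> cd; rewrite -subr_gt0; apply: (lt_le_trans cd); rewrite le_eqVlt; apply/orP; left; apply/eqP; ring.
have := IH _ Fh.
set A := h`_k.+2; set B := h`_k.+1; set C := h`_k.
rewrite -![_.+3%:R]natr1 -![_.+2%:R]natr1; set K := k.+1%:R.
have K0 : 0 < K by rewrite ltr0n.
move=> D; rewrite -subr_gt0 -(pmulr_rgt0 _ (_ : 0 < K + 1)) ?addr_gt0 //.
have -> : (K + 1) * ((K + 1) * (B - a * A) ^+ 2 - 2 * (K + 1 + 1) * (A * (C - a * B)))
  = (K + 2) * (K * B ^+ 2 - 2 * (K + 1) * (A * C)) + (B + (K + 1) * a * A) ^+ 2 by ring.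
by rewrite ltr_wpDr ?sqr_ge0 // mulr_gt0 // ?subr_gt0 // addr_gt0.
Qed.

Lemma coef_wronskianXn m w i : (size w <= m.+1)%N -> (m.*2 <= i)%N ->
  (wronskian 'X^(m.+1) w)`_i = w`_m *+ (i == m.*2).
Proof.
move=> sw mi; have mi' : (m <= i)%N by apply: leq_trans mi; rewrite -addnn leq_addr.
rewrite /wronskian derivXn mulrnAl coefB coefMn !coefXnM /= ltnNge mi' /=.
have [->|ne] := eqVneq i m.*2.
  rewrite -addnn addnK; case: m {sw mi mi'} => [|m]; first by rewrite mulr1n subr0.
  rewrite addSnnS ltnNge leq_addl /= coef_deriv addnK.
  by rewrite mulrS addrK.
have lt : (m.+1 <= i - m)%N by rewrite ltn_subRL addnn ltn_neqAle eq_sym ne.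
have wz : w`_(i - m) = 0 by apply: nth_default; apply: leq_trans lt.
case: ltnP => [_|h]; first by rewrite wz mul0rn subr0.
rewrite coef_deriv.
have -> : (i - m.+1).+1 = (i - m)%N by rewrite subnS prednK // (leq_trans _ lt).
by rewrite wz !mul0rn subr0.
Qed.

(** Split off the monomials of degree m + 1. The Wronskian is bilinear and alternating, so these two
    cancel against each other, and the remainders, of degree at most m, contribute only below degree
    2m. *)
Lemma coef_wronskian m u v i : (size u <= m.+2)%N -> (size v <= m.+2)%N -> (m.*2 <= i)%N ->
  (wronskian u v)`_i = wronskian_infty m.+1 u v *+ (i == m.*2).
Proof.
have split w : (size w <= m.+2)%N -> exists2 w1 : {poly R}, (size w1 <= m.+1)%N & w = w`_m.+1 *: 'X^(m.+1) + w1.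
  move=> sw; exists (w - w`_m.+1 *: 'X^(m.+1)); last by rewrite addrC subrK.
  apply/leq_sizeP => j; rewrite coefB coefZ coefXn leq_eqVlt => /predU1P[->|lt].
    by rewrite eqxx mulr1 subrr.
  by rewrite gtn_eqF // mulr0 subr0 nth_default // (leq_trans sw).
move=> /split[u1 su uE] /split[v1 sv vE] mi.
have um : u`_m = u1`_m by rewrite uE coefD coefZ coefXn ltn_eqF // mulr0 add0r.
have vm : v`_m = v1`_m by rewrite vE coefD coefZ coefXn ltn_eqF // mulr0 add0r.
rewrite /wronskian_infty /= um vm.
set a := u`_m.+1 in uE *; set b := v`_m.+1 in vE *.
have -> : wronskian u v = a *: wronskian 'X^(m.+1) v1 - b *: wronskian 'X^(m.+1) u1 + wronskian u1 v1.
  rewrite {um vm} uE vE /wronskian !derivD !derivZ -!mul_polyC.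
  ring.
have z (w1 w2 : {poly R}) : (size w1 <= m.+1)%N -> (size w2 <= m.+1)%N -> (w1^`() * w2)`_i = 0.
  move=> s1 s2; have [->|w10] := eqVneq w1 0; first by rewrite deriv0 mul0r coef0.
  have [->|w20] := eqVneq w2 0; first by rewrite mulr0 coef0.
  apply: nth_default; apply: leq_trans (size_polyMleq _ _) _.
  apply: leq_trans mi; rewrite -ltnS prednK; last first.
    by rewrite addn_gt0 [(0 < size w2)%N]lt0n size_poly_eq0 w20 orbT.
  have := leq_add (leq_trans (lt_size_deriv w10) s1) s2.
  by rewrite !addSn addnS !ltnS addnn.
rewrite coefD coefB !coefZ !coef_wronskianXn //.
rewrite [(wronskian u1 v1)`_i]coefB z // [u1 * _]mulrC z // subrr addr0.
by rewrite !mulrnAr -mulrnBl [u1`_m * _]mulrC.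
Qed.

(** By Laguerre's inequality f f'' < f'^2, so [f] and -f' have a negative Wronskian and
    interlace. *)
Lemma simple_real_derive k f : simple_real k.+2 f -> simple_real k.+1 f^`().
Proof.
move=> Ff; have [/andP[sf sf'] _] := Ff.
have W x : (wronskian f (- f^`())).[x] < 0.
  rewrite horner_wronskian derivN !hornerN mulrN mulrN -opprD oppr_lt0 -expr2 -subr_gt0.
  have := laguerre x Ff; set A := f.[x]; set B := _.[x]; set C := _.[x].
  rewrite -![_.+2%:R]natr1; set K := k.+1%:R; have K0 : 0 < K by rewrite ltr0n.
  have B0 := sqr_ge0 B.
  nra.
have sd := size_deriv f.
have sN : (k.+1 <= size f^`() <= k.+2)%N by rewrite sd; case: (size f) sf sf' => // l; rewrite !ltnS => -> ->.
have f0 := simple_real_neq0 Ff.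
have FN l : simple_real l (- f^`()) -> simple_real k.+1 f^`().
  move=> /(simple_realZ (c := -1)); rewrite oppr_eq0 oner_eq0 => /(_ isT).
  by rewrite scaleN1r opprK; apply: simple_real_level.
(* The level must be the exact degree of [f]: if [f] has a zero at infinity, the Wronskian at
   infinity for level k + 2 is zero. *)
move: sf'; rewrite leq_eqVlt => /orP[/eqP sE|sE].
  apply: (FN k.+2); apply: simple_real_wronskian Ff _ W _; rewrite ?size_polyN ?sd ?sE //.
  rewrite /wronskian_infty !coefN !coef_deriv /= (_ : f`_k.+3 = 0); last by rewrite nth_default ?sE.
  rewrite mul0rn oppr0 mulr0 subr0 mulrN mulrnAr oppr_lt0 -expr2 pmulrn_lgt0 //.
  by rewrite exprn_even_gt0 //= -[k.+2]/(k.+3.-1) -sE -/(lead_coef f) lead_coef_eq0.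
have {sE} sE : size f = k.+2 by apply/eqP; rewrite eqn_leq sf -ltnS sE.
apply: (FN k.+1); apply: simple_real_wronskian (simple_real_level _ Ff) _ W _; rewrite ?size_polyN ?sd ?sE ?leqnn ?leqnSn //.
rewrite /wronskian_infty !coefN !coef_deriv /= (_ : f`_k.+2 = 0); last by rewrite nth_default ?sE.
rewrite mul0rn oppr0 mulr0 subr0 mulrN mulrnAr oppr_lt0 -expr2 pmulrn_lgt0 //.
by rewrite exprn_even_gt0 //= -[k.+1]/(k.+2.-1) -sE -/(lead_coef f) lead_coef_eq0.
Qed.

End Interlacing.

(** * The finite free convolution operator *)

Section Convolution.
Set Implicit Arguments.
Unset Strict Implicit.
Variable R : realType.
Implicit Types (u v w p q f g h : {poly R}) (x y z : R).

(* [ffconv n f q] as a differential operator in [f]. *)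
Definition ffop (n : nat) q f : {poly R} :=
  \sum_(k < n.+1) (q`_(n - k) * (n - k)`!%:R / n`!%:R) *: f^`(k).

Lemma ffop_is_linear n q : linear (ffop n q).
Proof.
move=> a u v; rewrite /ffop scaler_sumr -big_split /=; apply: eq_bigr => k _.
by rewrite linearP scalerDr !scalerA mulrC.
Qed.

HB.instance Definition _ n q :=
  GRing.isLinear.Build R {poly R} {poly R} _ (ffop n q) (ffop_is_linear n q).

Lemma fact_neq0 n : n`!%:R != 0 :> R.
Proof. by rewrite pnatr_eq0 -lt0n fact_gt0. Qed.

Lemma deriv_ffop n q f : (ffop n q f)^`() = ffop n q f^`().
Proof.
rewrite /ffop raddf_sum; apply: eq_bigr => k _.
by rewrite /= derivZ -derivnS derivSn.
Qed.

Lemma derivn_mulX f k : ('X * f)^`(k.+1) = 'X * f^`(k.+1) + k.+1%:R *: f^`(k).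
Proof.
have := derivnMXaddC k f 0; rewrite addr0 mulrC => ->.
by rewrite addrC mulrC scaler_nat.
Qed.

(* The derivative of the form [y^N f(x/y)] in [y], at [y = 1]. *)
Definition polar (N : nat) f : {poly R} := N%:R *: f - 'X * f^`().

Lemma derivn_polar N f k : (polar N f)^`(k) = (N%:R - k%:R) *: f^`(k) - 'X * f^`(k.+1).
Proof.
rewrite /polar derivnB derivnZ; case: k => [|k].
  by rewrite !derivn0 subr0 derivn1.
by rewrite derivn_mulX -!derivSn scalerBl opprD addrA [RHS]addrAC.
Qed.

(** The coefficient of index n + 1 - k of the product splits in two. The part from ['X * g] gains a
    factor n + 1 - k, which is what [polar] produces, up to a term cancelled by ['X] times the
    derivative part. The part from [b] is shifted by one derivative. *)
Lemma ffop_mulXsubC n b g f : (size g <= n.+1)%N ->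
  n.+1%:R *: ffop n.+1 (('X - b%:P) * g) f
    = ('X - b%:P) * ffop n g f^`() + ffop n g (polar n.+1 f).
Proof.
move=> sg.
pose c k := g`_(n - k) * (n - k)`!%:R / n`!%:R.
transitivity (\sum_(k < n.+1) (c k * (n.+1%:R - k%:R)) *: f^`(k)
              - b *: \sum_(k < n.+1) c k *: f^`(k.+1)).
  (* [A] comes from ['X * g] and [B] from [b * g]. [A] vanishes at k = n + 1 and, by the bound on
     the size of [g], [B] vanishes at k = 0. *)
  pose A k := (if (n.+1 - k == 0)%N then 0 else g`_(n.+1 - k).-1) * (n.+1 - k)`!%:R / n`!%:R.
  pose B k := g`_(n.+1 - k) * (n.+1 - k)`!%:R / n`!%:R.
  have -> : n.+1%:R *: ffop n.+1 (('X - b%:P) * g) f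
      = \sum_(k < n.+2) (A k *: f^`(k)) - b *: \sum_(k < n.+2) (B k *: f^`(k)).
    rewrite !scaler_sumr -sumrB; apply: eq_bigr => k _.
    rewrite !scalerA -scalerBl; congr (_ *: _).
    rewrite mulrBl coefB coefXM coefCM factS natrM /A /B.
    have := fact_neq0 n; have : n.+1%:R != 0 :> R by rewrite pnatr_eq0.
    move: n`!%:R n.+1%:R (n.+1 - k)`!%:R (if _ then _ else _) => F N G E N0 F0.
    by field; rewrite F0.
  congr (_ - _ *: _).
    rewrite big_ord_recr /= /A subnn eqxx !mul0r scale0r addr0.
    apply: eq_bigr => k _; congr (_ *: _).
    have kn : (k <= n)%N by rewrite -ltnS.
    rewrite subSn //= /c factS natrM -subSn // natrB; last by rewrite ltnW // ltn_ord.
    have := fact_neq0 n; move: n`!%:R (n.+1%:R - _) (n - k)`!%:R g`__ => F N G E F0.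
    by field; exact: F0.
  rewrite big_ord_recl /= /B subn0 nth_default // !mul0r scale0r add0r.
  by apply: eq_bigr => k _; rewrite /bump /= add1n subSS.
have -> : \sum_(k < n.+1) c k *: f^`(k.+1) = ffop n g f^`().
  by apply: eq_bigr => k _; rewrite -derivSn.
have -> : ffop n g (polar n.+1 f) =
    \sum_(k < n.+1) (c k * (n.+1%:R - k%:R)) *: f^`(k) - 'X * ffop n g f^`().
  rewrite /ffop mulr_sumr -sumrB; apply: eq_bigr => k _.
  by rewrite derivn_polar -derivSn scalerBr scalerA -scalerAr.
rewrite -mul_polyC; ring.
Qed.

(** The term k = 0 is [f] itself, and all others have smaller degree. *)
Lemma size_coef_ffop n q f m : q`_n = 1 -> (size f <= m.+1)%N ->
  (size (ffop n q f) <= m.+1)%N /\ (ffop n q f)`_m = f`_m.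
Proof.
move=> q1 sf.
have E : ffop n q f - f = \sum_(k < n) (q`_(n - k.+1) * (n - k.+1)`!%:R / n`!%:R) *: f^`(k.+1).
  rewrite /ffop big_ord_recl /= subn0 q1 ?derivn0 mul1r divff ?fact_neq0 // scale1r.
  by rewrite addrC addKr.
have sE : (size (ffop n q f - f)%R <= m)%N.
  rewrite E; apply: leq_trans (size_sum _ _ _) _; apply/bigmax_leqP => k _.
  apply: leq_trans (size_scale_leq _ _) _.
  apply/leq_sizeP => j mj; rewrite coef_derivn nth_default ?mul0rn //.
  by rewrite (leq_trans sf) // addSn ltnS (leq_trans mj) ?leq_addl.
have -> : ffop n q f = f + (ffop n q f - f) by rewrite addrC subrK.
split; first by rewrite (leq_trans (size_polyD _ _)) // geq_max sf (leq_trans sE).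
by rewrite coefD [X in _ + X]nth_default // addr0.
Qed.

Lemma size_ffop n q f : q`_n = 1 -> size (ffop n q f) = size f.
Proof.
move=> q1; case E : (size f) => [|m].
  by move/eqP: E; rewrite size_poly_eq0 => /eqP->; rewrite raddf0 size_poly0.
have [s1 c1] := size_coef_ffop (m := m) q1 (eq_leq E).
apply/eqP; rewrite eqn_leq s1 ltnNge; apply/negP => /leq_sizeP/(_ _ (leqnn _)).
by rewrite c1 => /eqP; rewrite -[m]/(m.+1.-1) -E -/(lead_coef f) lead_coef_eq0 -size_poly_eq0 E.
Qed.

(** On the two top coefficients the operator acts by a unipotent triangular matrix, of determinant
    1. Its off-diagonal entry [t] is read off from the image of ['X^(m.+1)]. *)
Lemma wronskian_infty_ffop n q u v m : q`_n = 1 -> (size u <= m.+2)%N -> (size v <= m.+2)%N ->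
  wronskian_infty m.+1 (ffop n q u) (ffop n q v) = wronskian_infty m.+1 u v.
Proof.
move=> q1 su sv.
suff [t H] : exists t, forall w, (size w <= m.+2)%N -> (ffop n q w)`_m.+1 = w`_m.+1 /\
    (ffop n q w)`_m = w`_m + t * w`_m.+1.
  have [u1 u0] := H u su; have [v1 v0] := H v sv.
  rewrite /wronskian_infty /= u1 u0 v1 v0; ring.
exists (ffop n q 'X^(m.+1))`_m => w sw; split; first by have [] := size_coef_ffop q1 sw.
pose w1 := w - w`_m.+1 *: 'X^(m.+1).
have sw1 : (size w1 <= m.+1)%N.
  apply/leq_sizeP => j; rewrite coefB coefZ coefXn leq_eqVlt => /predU1P[<-|lt].
    by rewrite eqxx mulr1 subrr.
  by rewrite gtn_eqF // mulr0 subr0 nth_default // (leq_trans sw).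
have wE : w = w1 + w`_m.+1 *: 'X^(m.+1) by rewrite subrK.
have [_ c1] := size_coef_ffop q1 sw1.
rewrite {1}wE linearD linearZ /= coefD c1 coefZ coefB coefZ coefXn ltn_eqF // mulr0 subr0.
by rewrite [_ * w`__]mulrC.
Qed.

(** Adding a multiple of [u] to [v] leaves the Wronskian with [u] unchanged, so the whole pencil
    inherits simple real zeros. *)
Lemma simple_real_comb m u v a b :
    simple_real m.+1 u -> (size v <= m.+2)%N ->
    (forall x, (wronskian u v).[x] < 0) -> wronskian_infty m.+1 u v < 0 ->
  (a != 0) || (b != 0) -> simple_real m.+1 (a *: u + b *: v).
Proof.
move=> Fu sv W Wi; have [/andP[_ su] _] := Fu.
have [->|b0] := eqVneq b 0.
  by rewrite orbF scale0r addr0 => a0; apply: simple_realZ.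
move=> _; suff : simple_real m.+1 (v + (a / b) *: u).
  by move=> /(simple_realZ b0); rewrite scalerDr scalerA mulrCA divff // mulr1 addrC.
apply: (simple_real_wronskian Fu).
- by rewrite (leq_trans (size_polyD _ _)) // geq_max sv (leq_trans (size_scale_leq _ _)).
- move=> x; have := W x; rewrite !horner_wronskian derivD derivZ !hornerD !hornerZ.
  by congr (_ < _); ring.
- by move: Wi; rewrite /wronskian_infty /= !coefD !coefZ; congr (_ < _); ring.
Qed.

(* A zero of the Wronskian of the images gives a combination of [u] and [v]
   whose image has a double root. *)
Lemma wronskian_ffop n q u v : q`_n.+1 = 1 ->
    (forall p, simple_real n.+1 p -> simple_real n.+1 (ffop n.+1 q p)) ->
    simple_real n.+1 u -> (size v <= n.+2)%N ->
    (forall x, (wronskian u v).[x] < 0) -> wronskian_infty n.+1 u v < 0 ->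
  forall x, (wronskian (ffop n.+1 q u) (ffop n.+1 q v)).[x] < 0.
Proof.
move=> q1 Tpres Fu sv W Wi; have [/andP[_ su] _] := Fu.
set T := ffop n.+1 q.
have comb a b := @simple_real_comb _ _ _ a b Fu sv W Wi.
have TE a b : T (a *: u + b *: v) = a *: T u + b *: T v by rewrite /T linearD !linearZ.
have W0 x : (wronskian (T u) (T v)).[x] != 0.
  apply/negP; rewrite horner_wronskian => /eqP Wx.
  have [a [b [ab e0 e1]]] : exists a b, [/\ (a != 0) || (b != 0),
      a * (T u).[x] + b * (T v).[x] = 0 & a * (T u)^`().[x] + b * (T v)^`().[x] = 0].
    have [/andP[/eqP u0 /eqP v0]|nz] := boolP (((T u).[x] == 0) && ((T v).[x] == 0)).
      have [/andP[/eqP u1 /eqP v1]|nz] := boolP (((T u)^`().[x] == 0) && ((T v)^`().[x] == 0)).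
        by exists 1, 0; rewrite oner_eq0 u0 v0 u1 v1 !mulr0 addr0.
      exists (T v)^`().[x], (- (T u)^`().[x]); rewrite oppr_eq0 orbC -negb_and nz u0 v0 !mulr0 addr0.
      by split=> //; ring.
    exists (T v).[x], (- (T u).[x]); rewrite oppr_eq0 orbC -negb_and nz; split=> //; first by ring.
    by rewrite -Wx; ring.
  have Fc := Tpres _ (comb _ _ ab); rewrite -/T TE in Fc.
  have rx : root (a *: T u + b *: T v) x by rewrite /root !hornerE e0.
  by have := simple_real_deriv Fc rx; rewrite derivD !derivZ hornerD !hornerZ e1 eqxx.
have sTu : (size (T u) <= n.+2)%N by rewrite size_ffop.
have sTv : (size (T v) <= n.+2)%N by rewrite size_ffop.
have cW := coef_wronskian sTu sTv.
rewrite wronskian_infty_ffop // in cW.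
(* A Wronskian without zeros has constant sign, and its value at infinity is its leading
   coefficient. *)
have lW : lead_coef (wronskian (T u) (T v)) = wronskian_infty n.+1 u v.
  rewrite /lead_coef; suff -> : size (wronskian (T u) (T v)) = n.*2.+1 by rewrite cW // eqxx.
  apply/eqP; rewrite eqn_leq; apply/andP; split.
    by apply/leq_sizeP => j lt; rewrite cW ?(ltnW lt) // gtn_eqF.
  rewrite ltnNge; apply/negP => /leq_sizeP/(_ _ (leqnn _)).
  by rewrite cW // eqxx => /eqP; rewrite lt_eqF.
move=> x; rewrite ltNge le_eqVlt eq_sym (negPf (W0 x)) /=; apply/negP => Wx.
have [|z _ /rootP rz] := @root_gt_of_lead R (wronskian (T u) (T v)) x.
  by rewrite lW pmulr_rlt0.
by have := W0 z; rewrite rz eqxx.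
Qed.

(** * Polar derivatives and preservation of simple real zeros *)

Lemma coef_polar N f i : (polar N f)`_i = (N%:R - i%:R) * f`_i.
Proof.
rewrite /polar coefB coefZ coefXM coef_deriv; case: i => [|i] /=.
  by rewrite !subr0.
by rewrite -[f`__ *+ _]mulr_natl mulrBl.
Qed.

Lemma size_polar N f : (size f <= N.+1)%N -> (size (polar N f) <= N)%N.
Proof.
move=> sf; apply/leq_sizeP => j; rewrite coef_polar leq_eqVlt => /predU1P[<-|lt].
  by rewrite subrr mul0r.
by rewrite [f`__]nth_default ?mulr0 // (leq_trans sf).
Qed.

Lemma deriv_polar N f : (polar N.+1 f)^`() = polar N f^`().
Proof.
by rewrite /polar derivB derivZ derivM derivX mul1r -natr1 scalerDl scale1r opprD addrA addrK.
Qed.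

(** The two polynomials are the partial derivatives of the form of degree k + 2. Expanding their
    Wronskian gives exactly the difference in Laguerre's inequality. *)
Lemma wronskian_polar_lt0 k f x : simple_real k.+2 f ->
  (wronskian f^`() (polar k.+2 f)).[x] < 0.
Proof.
move=> /(laguerre x); rewrite -subr_lt0 horner_wronskian deriv_polar.
rewrite /polar !(hornerD, hornerZ, hornerN, hornerM, hornerX) -[k.+2%:R]natr1.
by congr (_ < _); ring.
Qed.

Lemma wronskian_infty_polar_lt0 k f : simple_real k.+2 f ->
  wronskian_infty k.+1 f^`() (polar k.+2 f) < 0.
Proof.
move=> /newton; rewrite -subr_lt0 /wronskian_infty /= !coef_polar !coef_deriv -![_`__ *+ _]mulr_natl.
by congr (_ < _); rewrite -![k.+2%:R]natr1 -![k.+1%:R]natr1; ring.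
Qed.

Lemma coef_prod_XsubC_size (s : seq R) : (\prod_(b <- s) ('X - b%:P))`_(size s) = 1.
Proof.
by have := lead_coef_prod_XsubC s xpredT id; rewrite /lead_coef size_prod_XsubC.
Qed.

Lemma simple_real_ffop (s : seq R) f : simple_real (size s) f ->
  simple_real (size s) (ffop (size s) (\prod_(b <- s) ('X - b%:P)) f).
Proof.
elim: s f => [|b s IH] f Ff.
  by rewrite /ffop big_nil big_ord_recl big_ord0 subn0 fact0 coef1 divr1 mulr1 addr0 scale1r derivn0.
have q1 := coef_prod_XsubC_size (b :: s).
have [/andP[sf sf'] _] := Ff.
set w := ffop _ _ f.
have sw : size w = size f by rewrite size_ffop.
(* Degree 1 is apart, since [simple_real_derive] starts at level 2. *)
case: (posnP (size s)) => [s0|].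
  move: Ff; rewrite /= s0 => Ff; apply: simple_real_linear; rewrite sw.
  by rewrite /= s0 in sf sf'; rewrite sf sf'.
case E : (size s) => [//|m] _.
rewrite /= E in Ff sf sf' w sw *; rewrite E in IH.
set g := \prod_(b <- s) ('X - b%:P) in IH.
have g1 : g`_m.+1 = 1 by rewrite /g -E coef_prod_XsubC_size.
have sg : (size g <= m.+2)%N by rewrite size_prod_XsubC E.
have Fd := simple_real_derive Ff.
have svp := size_polar sf'.
have W := wronskian_ffop g1 IH Fd svp (fun x => wronskian_polar_lt0 x Ff) (wronskian_infty_polar_lt0 Ff).
have Wi := wronskian_infty_polar_lt0 Ff.
have FU := IH _ Fd.
have sd : size f^`() = (size f).-1 := size_deriv f.
have sU : size (ffop m.+1 g f^`()) = (size f).-1 by rewrite size_ffop.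
have sV : (size (ffop m.+1 g (polar m.+2 f)) <= m.+2)%N by rewrite size_ffop.
rewrite -(wronskian_infty_ffop g1 _ svp) in Wi; last by rewrite sd -ltnS prednK // (leq_trans _ sf).
have wE : m.+2%:R *: w = ('X - b%:P) * ffop m.+1 g f^`() + ffop m.+1 g (polar m.+2 f).
  by rewrite /w big_cons ffop_mulXsubC.
move: W Wi FU sU sV wE.
set U := ffop _ _ f^`(); set V := ffop _ _ (polar _ _) => W Wi FU sU sV wE.
have N0 : m.+2%:R != 0 :> R by rewrite pnatr_eq0.
suff [l Fw] : exists l, simple_real l (m.+2%:R *: w).
  apply: (simple_real_level (k := l)); first by rewrite sw sf.
  have := simple_realZ (invr_neq0 N0) Fw.
  by rewrite scalerA mulVf // scale1r.
(* Adding [('X - b%:P) * U] to [V] lowers the Wronskian with [U] by the square of [U]. *)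
have Ww x : (wronskian U (m.+2%:R *: w)).[x] < 0.
  rewrite wE; have := W x; rewrite !horner_wronskian derivD derivM derivXsubC mul1r.
  rewrite !(hornerXsubC, hornerM, hornerD).
  have := sqr_ge0 U.[x]; set A := U.[x]; set B := U^`().[x]; set C := V.[x]; set D := V^`().[x].
  move=> A0; rewrite -subr_gt0 => WA; rewrite -subr_gt0; apply: (lt_le_trans WA).
  rewrite -subr_ge0; apply: le_trans A0 _; rewrite le_eqVlt; apply/orP; left; apply/eqP; ring.
have swN : size (m.+2%:R *: w) = size f by rewrite size_scale.
have cw i : (m.+2%:R *: w)`_i.+1 = U`_i - b * U`_i.+1 + V`_i.+1.
  by rewrite wE mulrBl coefD coefB coefXM coefCM.
have [/andP[sU1 sU2] _] := FU.
(* If [f] has full degree, the level is m + 2 and the value at infinity is minus the square of the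
   leading coefficient of [U]. Otherwise the level is m + 1, and the value for [U] and [V] is
   lowered by a square. *)
move: sf'; rewrite leq_eqVlt => /orP[/eqP sE|sE].
  exists m.+2; apply: simple_real_wronskian (simple_real_level _ FU) _ Ww _; rewrite ?swN ?sU ?sE ?leqnn ?leqnSn //.
  rewrite /wronskian_infty /= !cw.
  have -> : U`_m.+2 = 0 by rewrite nth_default ?sU ?sE.
  have -> : V`_m.+2 = 0 by rewrite nth_default.
  rewrite mul0r mulr0 subr0 addr0 sub0r oppr_lt0 -expr2 exprn_even_gt0 //=.
  by rewrite -[m.+1]/(m.+2.-1) -[m.+2]/(m.+3.-1) -sE -sU -/(lead_coef U) lead_coef_eq0 (simple_real_neq0 FU).
have {sE} sE : size f = m.+2 by apply/eqP; rewrite eqn_leq sf -ltnS sE.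
exists m.+1; apply: simple_real_wronskian FU _ Ww _; rewrite ?swN ?sE //.
move: Wi; rewrite /wronskian_infty /= cw.
have -> : U`_m.+1 = 0 by rewrite nth_default ?sU ?sE.
rewrite !mul0r !sub0r !oppr_lt0 mulr0 subr0 mulrDr -expr2 => Wi.
by rewrite ltr_wpDl ?sqr_ge0.
Qed.

End Convolution.

(** * Images of cofactors at the roots, translations, and agreement with [ffconv] *)

Section ConvolutionRoots.
Set Implicit Arguments.
Unset Strict Implicit.
Variable R : realType.
Implicit Types (u v w p q f g h : {poly R}) (x y z : R).

(* [f] and [h + e f'] interlace strictly for every [e > 0]; let [e] tend to 0. *)
Lemma ffop_derivative_ge0 (s : seq R) f h a x :
    simple_real (size s) f -> (1 < size s)%N -> f = ('X - a%:P) * h -> size h = size s ->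
    let T := ffop (size s) (\prod_(b <- s) ('X - b%:P)) in
    root (T f) x ->
  0 <= (T f)^`().[x] * (T h).[x].
Proof.
move=> Ff s1 fE sh T /rootP rx.
have q1 := coef_prod_XsubC_size s; set q := \prod_(b <- s) _ in q1 T rx *.
case E : (size s) s1 => [//|[//|m]] _.
have Tpres := @simple_real_ffop _ s; rewrite E -/q in Ff q1 Tpres sh; rewrite /T {T} E in rx *.
set T := ffop m.+2 q in rx *.
have h0 : h != 0 by rewrite -size_poly_eq0 sh.
have sf : size f = m.+3 by rewrite fE (size_monicM (monicXsubC a) h0) size_XsubC sh.
have sd : size f^`() = m.+2 by rewrite size_deriv sf.
have key e : 0 < e -> 0 < (T f)^`().[x] * ((T h).[x] + e * (T f)^`().[x]).
  move=> e0.
  have := @wronskian_ffop _ _ q f (- (h + e *: f^`())) q1 Tpres Ff.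
  have -> : (size (- (h + e *: f^`()))%R <= m.+3)%N.
    rewrite size_polyN (leq_trans (size_polyD _ _)) // geq_max sh leqnSn /=.
    by rewrite (leq_trans (size_scale_leq _ _)) // sd leqnSn.
  move=> /(_ isT) H.
  have TE : T (- (h + e *: f^`())) = - (T h + e *: (T f)^`()).
    by rewrite /T deriv_ffop linearN linearD linearZ.
  have {H} := H _ _ x; rewrite horner_wronskian -/T TE.
  rewrite rx mul0r subr0 hornerN mulrN oppr_lt0 hornerD hornerZ; apply.
    (* Here f' h - f h' = h^2 may vanish. The summand with [e] makes the inequality strict, as f'^2
       - f f'' is positive by Laguerre. *)
    move=> z; rewrite horner_wronskian derivN derivD derivZ !(hornerN, hornerD, hornerZ).
    have := laguerre z Ff.
    have -> : f.[z] = (z - a) * h.[z] by rewrite fE hornerM hornerXsubC.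
    have -> : f^`().[z] = h.[z] + (z - a) * h^`().[z].
      by rewrite fE derivM derivXsubC mul1r hornerD hornerM hornerXsubC.
    set A := h.[z]; set B := h^`().[z]; set C := _.[z]; set y := z - a.
    rewrite -[m.+2%:R]natr1; set K := m.+1%:R; have K0 : 0 < K by rewrite ltr0n.
    move=> D.
    have D' : 0 < (K + 1) * ((A + y * B) ^+ 2 - y * A * C).
      by have := sqr_ge0 (A + y * B); nra.
    have K1 : 0 < K + 1 by rewrite addr_gt0.
    rewrite pmulr_rgt0 // in D'.
    have := mulr_gt0 e0 D'; have := sqr_ge0 A.
    nra.
  have fm : f`_m.+2 = h`_m.+1 by rewrite fE mulrBl coefB coefXM coefCM /= [h`_m.+2]nth_default ?sh // mulr0 subr0.
  rewrite /wronskian_infty /= !coefN !coefD !coefZ coef_deriv fm [h`_m.+2]nth_default ?sh //.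
  rewrite [f^`()`_m.+2]nth_default ?sd // mulr0 addr0 oppr0 mulr0 subr0 mulrN oppr_lt0.
  have A0 : 0 < h`_m.+1 ^+ 2.
    by rewrite exprn_even_gt0 //= -[m.+1]/(m.+2.-1) -sh -/(lead_coef h) lead_coef_eq0.
  rewrite -[_ *+ _]mulr_natr; have := ltr0Sn R m.+1; move: m.+2%:R => M M0.
  have -> : h`_m.+1 * (h`_m.+1 + e * (h`_m.+1 * M)) = h`_m.+1 ^+ 2 * (1 + e * M) by ring.
  by rewrite mulr_gt0 // addr_gt0 // mulr_gt0.
rewrite leNgt; apply/negP => lt0.
have d0 : (T f)^`().[x] != 0 by apply: contraTneq lt0 => ->; rewrite mul0r ltxx.
have d2 : 0 < (T f)^`().[x] ^+ 2 by rewrite exprn_even_gt0.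
(* This value of [e] makes the second factor in [key] vanish. *)
have := key (- ((T f)^`().[x] * (T h).[x]) / (T f)^`().[x] ^+ 2).
rewrite divr_gt0 ?oppr_gt0 // => /(_ isT).
suff -> : (T f)^`().[x] * ((T h).[x] + - ((T f)^`().[x] * (T h).[x]) / (T f)^`().[x] ^+ 2 * (T f)^`().[x]) = 0.
  by rewrite ltxx.
by field.
Qed.

(* With [c = x - b], both values are, up to a factor [n], values at [x] of the
   convolutions of the polar derivatives of [f] and [h] at [c] with
   [\prod_(b <- s) ('X - b%:P)]. *)
Lemma ffop_cofactor_neq0 (s : seq R) b f h (w : R) x :
    let n := (size s).+1 in
    let T := ffop n (('X - b%:P) * \prod_(b <- s) ('X - b%:P)) in
    (0 < size s)%N -> simple_real n f -> f = ('X - w%:P) * h -> size h = n ->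
    h.[x - b] != 0 -> root (T f) x ->
  (T h).[x] != 0.
Proof.
move=> n T s0 Ff fE sh hc /rootP rx; apply/negP => /eqP Th.
have g1 := coef_prod_XsubC_size s; set g := \prod_(b <- s) _ in g1 T rx Th.
have sg : size g = (size s).+1 by rewrite size_prod_XsubC.
case E : (size s) s0 => [//|m] _.
have Tpres := @simple_real_ffop _ s; rewrite /n E -/g in Ff g1 Tpres sh sg.
rewrite /T /n E in rx Th; move=> {T n}.
set c := x - b in hc.
have polarE p : m.+2%:R * (ffop m.+2 (('X - b%:P) * g) p).[x]
    = (ffop m.+1 g (polar m.+2 p + c *: p^`())).[x].
  rewrite -hornerZ ffop_mulXsubC ?sg // (linearD _ (polar m.+2 p) (c *: _)) linearZ /= !hornerD hornerM hornerZ hornerXsubC.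
  by rewrite -/c addrC.
have phi0 := polarE f; rewrite rx mulr0 in phi0.
have psi0 := polarE h; rewrite Th mulr0 in psi0.
have [/andP[sf sf'] _] := Ff.
have Fd := simple_real_derive Ff.
have Fphi : simple_real m.+1 (polar m.+2 f + c *: f^`()).
  have := simple_real_comb Fd (size_polar sf') (fun z => wronskian_polar_lt0 z Ff) (wronskian_infty_polar_lt0 Ff).
  by move=> /(_ c 1); rewrite oner_eq0 orbT scale1r addrC => /(_ isT).
have Fh : simple_real m.+1 h.
  have rw : root f w by rewrite fE rootM root_XsubC eqxx.
  have [h' [fE2 Fh' _]] := simple_real_factor Ff rw.
  by move: fE2; rewrite fE => /(mulfI (negbT (polyXsubC_eq0 w))) ->.
have hlin : m = 0%N -> h = h`_1 *: 'X + (h`_0)%:P.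
  by move=> m0; apply: poly_size2E; rewrite sh m0.
set phi := polar _ f + _ in phi0 Fphi; set psi := polar _ h + _ in psi0.
have K0 : 0 < m%:R + 1 :> R by rewrite natr1 ltr0n.
have K1 : 0 < m%:R + 1 + 1 :> R by rewrite addr_gt0.
have W z : (wronskian phi (- psi)).[z] < 0.
  rewrite horner_wronskian derivN /phi /psi (derivD (polar _ f)) (derivD (polar _ h)).
  rewrite !derivZ !deriv_polar.
  rewrite /polar !(hornerN, hornerD, hornerZ, hornerM, hornerX).
  have -> : f.[z] = (z - w) * h.[z] by rewrite fE hornerM hornerXsubC.
  have -> : f^`().[z] = h.[z] + (z - w) * h^`().[z].
    by rewrite fE derivM derivXsubC mul1r hornerD hornerM hornerXsubC.
  have -> : f^`()^`().[z] = 2 * h^`().[z] + (z - w) * h^`()^`().[z].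
    by rewrite fE deriv2_mulXsubC hornerD hornerZ hornerM hornerXsubC.
  rewrite -[m.+2%:R]natr1 -[m.+1%:R]natr1.
  (* This is m + 1 times minus the Wronskian. Away from [c] Laguerre's inequality for [h] makes it
     positive, and at [c] the first square does, as [h.[c]] is nonzero. For m = 0, [h] is linear and
     the first square is that of [h.[c]]. *)
  have : 0 < (m%:R + 1 + 1) * ((m%:R + 1) * h.[z] - (z - c) * h^`().[z]) ^+ 2
     + (z - c) ^+ 2 * (m%:R * h^`().[z] ^+ 2 - (m%:R + 1) * (h.[z] * h^`()^`().[z])).
    have [zc|zc] := eqVneq z c.
      rewrite zc subrr expr0n /= !mul0r addr0 subr0 mulr_gt0 // exprn_even_gt0 //=.
      by rewrite mulf_neq0 // gt_eqF.
    case: (m) hlin Fh => [/(_ erefl) hE _|k _ Fh'].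
      have hx t : h.[t] = h`_1 * t + h`_0 by rewrite {1}hE !hornerE.
      have dh : h^`() = (h`_1)%:P by rewrite hE derivD derivZ derivX derivC addr0 !coefE /= mulr1 addr0 alg_polyC.
      rewrite dh derivC horner0 hornerC hx.
      have := hc; rewrite hx => hc'.
      have : 0 < (h`_1 * c + h`_0) ^+ 2 by rewrite exprn_even_gt0.
      move: (h`_1) (h`_0) => p q pq.
      rewrite -(pmulr_rgt0 _ (ltr0Sn R 1)) in pq.
      have := pq; congr (_ < _); ring.
    rewrite natr1 ltr_wpDl //; first by rewrite mulr_ge0 ?sqr_ge0 // natr1 ler0n.
    rewrite mulr_gt0 ?exprn_even_gt0 //= ?subr_eq0 // subr_gt0.
    exact: laguerre.
  move: (m%:R : R) K0 K1 h.[z] h^`().[z] h^`()^`().[z] => M K0 K1 A B C D.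
  rewrite -oppr_gt0 -(pmulr_rgt0 _ K0).
  by apply: lt_le_trans D _; rewrite le_eqVlt; apply/orP; left; apply/eqP; ring.
have Wi : wronskian_infty m.+1 phi (- psi) < 0.
  rewrite /wronskian_infty /= !coefN /phi /psi !(coefD (polar _ _)) !coefZ !coef_polar !coef_deriv.
  have f2 : f`_m.+2 = h`_m.+1.
    by rewrite fE mulrBl coefB coefXM coefCM /= [h`_m.+2]nth_default ?sh // mulr0 subr0.
  have f1 : f`_m.+1 = h`_m - w * h`_m.+1 by rewrite fE mulrBl coefB coefXM coefCM.
  have f0 : f`_m = (if m == 0%N then 0 else h`_m.-1) - w * h`_m.
    by rewrite fE mulrBl coefB coefXM coefCM.
  rewrite f2 f1 f0 [h`_m.+2]nth_default ?sh // mul0rn mulr0 addr0.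
  rewrite -![_`__ *+ _]mulr_natr -[(_ - _) *+ _]mulr_natr -[m.+2%:R]natr1 -[m.+1%:R]natr1.
  (* The same decomposition at infinity, with Newton's inequality. The conditional stands for the
     coefficient of index m - 1, which must read as 0 when m = 0 although [m.-1] is then 0. *)
  have : 0 < (m%:R + 1 + 1) * (h`_m + c * (m%:R + 1) * h`_m.+1) ^+ 2
     + (m%:R * h`_m ^+ 2 - 2 * (m%:R + 1) * (h`_m.+1 * (if m == 0%N then 0 else h`_m.-1))).
    case: (m) hlin Fh => [/(_ erefl) hE _|k _ Fh'] /=.
      have hx t : h.[t] = h`_1 * t + h`_0 by rewrite {1}hE !hornerE.
      have := hc; rewrite hx => hc'.
      have : 0 < (h`_1 * c + h`_0) ^+ 2 by rewrite exprn_even_gt0.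
      move: (h`_1) (h`_0) => p q pq.
      rewrite -(pmulr_rgt0 _ (ltr0Sn R 1)) in pq.
      have := pq; congr (_ < _); ring.
    rewrite natr1 ltr_wpDl //; first by rewrite mulr_ge0 ?sqr_ge0 // natr1 ler0n.
    by rewrite subr_gt0 newton.
  move: (m%:R : R) K0 K1 h`_m.+1 h`_m (if _ then _ else _) => M K0 K1 A B C D.
  rewrite -oppr_gt0 -(pmulr_rgt0 _ K0).
  by apply: lt_le_trans D _; rewrite le_eqVlt; apply/orP; left; apply/eqP; ring.
have spsi : (size (- psi) <= m.+2)%N.
  rewrite size_polyN (leq_trans (size_polyD _ _)) // geq_max size_polar ?sh //=.
  by rewrite (leq_trans (size_scale_leq _ _)) // size_deriv sh.
(* The images of [phi] and [psi] would both vanish at [x], and so would their Wronskian. *)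
have := wronskian_ffop g1 Tpres Fphi spsi W Wi x.
rewrite horner_wronskian [ffop _ _ (- _)]linearN derivN !hornerN /=.
by rewrite -phi0 -psi0 oppr0 mulr0 mul0r subrr ltxx.
Qed.

(** Convolution with a point mass is a translation: in the peeling identity the two terms with f'
    cancel after composition. *)
Lemma ffop_XsubC_exp n b f : (size f <= n.+1)%N ->
  ffop n (('X - b%:P) ^+ n) f = f \Po ('X - b%:P).
Proof.
elim: n f => [|n IH] f sf.
  rewrite /ffop big_ord_recl big_ord0 expr0 coef1 fact0 divr1 mulr1 scale1r addr0 derivn0.
  by rewrite (size1_polyC sf) comp_polyC.
have N0 : n.+1%:R != 0 :> R by rewrite pnatr_eq0.
apply: (scalerI N0); rewrite exprS ffop_mulXsubC; last first.
  by rewrite size_exp_XsubC.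
rewrite IH; last by rewrite size_deriv; case: (size f) sf.
rewrite IH; last exact: size_polar.
by rewrite /polar comp_polyB comp_polyZ comp_polyM comp_polyX addrC subrK.
Qed.

(** Only the terms k = 0 and k = 1 reach degree n. This makes the sum of the roots additive. *)
Lemma coef_pred_ffop n q f : q`_n.+1 = 1 -> (size f <= n.+2)%N -> f`_n.+1 = 1 ->
  (ffop n.+1 q f)`_n = f`_n + q`_n.
Proof.
move=> q1 sf f1.
rewrite /ffop !big_ord_recl /= !coefD coef_sum big1 => [|k _].
  rewrite subn0 q1 mul1r divff ?fact_neq0 // scale1r addr0; congr (_ + _).
  rewrite /bump /= subSS subn0 coefZ coef_deriv f1 factS natrM.
  have := fact_neq0 R n; have : n.+1%:R != 0 :> R by rewrite pnatr_eq0.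
  move: n`!%:R n.+1%:R => F N N0 F0.
  by field; rewrite F0.
rewrite coefZ -[f^`(0 + k)]/(f^`(k)) -!derivnS coef_derivn [f`__]nth_default ?mul0rn ?mulr0 //.
by rewrite (leq_trans sf) // !addSn !ltnS leq_addl.
Qed.

(** Only derivatives of order at most n - m reach the coefficient of ['X^m]. Reversing that order
    turns it into the index of the coefficient of [f], and falling factorials reconcile the
    weights. *)
Lemma ffconvE n f q : (size f <= n.+1)%N -> ffconv n f q = ffop n q f.
Proof.
move=> sf; apply/polyP => m; rewrite /ffconv /ffop !coef_sum.
have [mn|nm] := leqP m n; last first.
  rewrite !big1 // => k _; rewrite coefZ.
    by rewrite coef_derivn [f`__]nth_default ?mul0rn ?mulr0 // (leq_trans sf) // (leq_trans nm) ?leq_addl.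
  by rewrite coefXn gtn_eqF ?mulr0 // (leq_ltn_trans _ nm) ?leq_subr.
have kn : (n - m < n.+1)%N by rewrite ltnS leq_subr.
rewrite (bigD1 (Ordinal kn)) //= [X in _ + X]big1 ?addr0 => [|i ni]; last first.
  rewrite coefZ coefXn; case: eqP => [mE|]; last by rewrite mulr0.
  by case/eqP: ni; apply: val_inj; rewrite /= mE subKn // -ltnS ltn_ord.
rewrite coefZ coefXn subKn // eqxx mulr1 /ffconv_coef subKn //.
rewrite [RHS](bigID (fun k : 'I_n.+1 => (k < (n - m).+1)%N)) /= [X in _ = _ + X]big1 ?addr0; last first.
  move=> k; rewrite -leqNgt => km; rewrite coefZ coef_derivn [f`__]nth_default ?mul0rn ?mulr0 //.
  by rewrite (leq_trans sf) // -[n in (n < _)%N](subnK mn) -addSn leq_add2r.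
rewrite -(big_ord_widen_cond n.+1 xpredT
  (fun k => (q`_(n - k) * (n - k)`!%:R / n`!%:R *: f^`(k))`_m)) // mulr_sumr.
rewrite [RHS](reindex_inj rev_ord_inj) /=; apply: eq_bigr => i _.
have im : (i <= n - m)%N by rewrite -ltnS.
rewrite subSS; set j := (n - m - i)%N.
have inn : (i <= n)%N by rewrite (leq_trans im) ?leq_subr.
have jE : (n - i = j + m)%N.
  by rewrite /j subnAC subnK // leq_subRL // addnC -leq_subRL.
have sgn : (-1) ^+ (n - m) = (-1) ^+ i * (-1) ^+ j :> R by rewrite -exprD subnKC.
rewrite coefZ coef_derivn /sgcoef jE sgn.
have := ffact_fact (leq_addr m j); rewrite addKn => <-.
have := sqrr_sign R i; have := sqrr_sign R j.
rewrite -[f`__ *+ _]mulr_natr !natrM; have := fact_neq0 R n; have := fact_neq0 R m.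
move: (n - j)`!%:R n`!%:R m`!%:R (_ ^_ _)%:R (q`_(n - j)) (f`_(j + m)) ((-1) ^+ i) ((-1) ^+ j).
move=> F G H K q' f' a b H0 G0 bb aa.
transitivity ((a ^+ 2 * b ^+ 2) * (q' * F / G * (f' * K))); last by rewrite aa bb !mul1r.
by field; rewrite G0.
Qed.

End ConvolutionRoots.

(** * Scores and the Jacobian of the roots *)

Section RootPolynomials.
Set Implicit Arguments.
Unset Strict Implicit.
Variable R : realType.
Implicit Types (u v w p q f g h : {poly R}) (x y z : R).

(** Strict convexity of |x|^r, as a tangent line at [m] of slope sg(m) r |m|^(r-1). Scaling by |m|
    reduces it to the strict Bernoulli inequality [bern]. *)
Lemma powR_tangent (r m : R) : 1 < r ->
  exists k, forall x, x != m -> `|m| `^ r + k * (x - m) < `|x| `^ r.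
Proof.
move=> r1; have r0 : 0 < r by apply: lt_trans r1.
have bern t : 0 <= t -> t != 1 -> 1 + r * (t - 1) < t `^ r.
  rewrite le_eqVlt => /predU1P[<- _|t0 t1].
    by rewrite powR0 ?gt_eqF // sub0r mulrN1 subr_lt0.
  (* With [L = ln t]: [e^((r-1)L) > 1 + (r-1)L] and [e^(-L) > 1 - L], with weights [t] and [(r-1)t]. *)
  have L0 : ln t != 0 by rewrite ln_eq0.
  have h1 := expR_gt1Dx (_ : (r - 1) * ln t != 0).
  have h2 := expR_gt1Dx (_ : - ln t != 0).
  rewrite oppr_eq0 in h2; have {}h2 := h2 L0.
  rewrite mulf_eq0 subr_eq0 gt_eqF //= in h1; have {}h1 := h1 L0.
  rewrite expRN lnK ?posrE // in h2.
  have e1 : t `^ r = t * expR ((r - 1) * ln t).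
    rewrite /powR gt_eqF // -{2}(lnK t0) -expRD; congr expR; ring.
  have h1' : t * (1 + (r - 1) * ln t) < t `^ r by rewrite e1 ltr_pM2l.
  have h2' : t * (1 - ln t) < 1.
    have : t * (1 - ln t) < t * t^-1 by rewrite ltr_pM2l.
    by rewrite mulfV // gt_eqF.
  have h3 : (r - 1) * (t * (1 - ln t)) < r - 1 by rewrite gtr_pMr // subr_gt0.
  have := ltrD h1' h3; rewrite -subr_gt0 => h4; rewrite -subr_gt0.
  by apply: lt_le_trans h4 _; rewrite le_eqVlt; apply/orP; left; apply/eqP; ring.
have [->|m0] := eqVneq m 0.
  exists 0 => x x0; rewrite normr0 powR0 ?gt_eqF // mul0r addr0.
  by rewrite powR_gt0 // normr_gt0.
have M0 : 0 < `|m| by rewrite normr_gt0.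
have P0 : 0 < `|m| `^ r by rewrite powR_gt0.
exists (Num.sg m * (r * `|m| `^ r / `|m|)) => x xm.
have xE : `|x| `^ r = `|m| `^ r * (`|x| / `|m|) `^ r.
  by rewrite -powRM ?divr_ge0 // mulrC divfK // gt_eqF.
have mE : Num.sg m * m = `|m| by rewrite -normrEsg.
have sx : Num.sg m * x <= `|x|.
  by rewrite (le_trans (ler_norm _)) // normrM normr_sg m0 mul1r.
have lin : `|m| `^ r + Num.sg m * (r * `|m| `^ r / `|m|) * (x - m)
    = `|m| `^ r * (1 + r * ((Num.sg m * x) / `|m| - 1)).
  have -> : Num.sg m * (r * `|m| `^ r / `|m|) * (x - m) = (r * `|m| `^ r / `|m|) * (Num.sg m * x - `|m|).
    by rewrite -{5}mE; ring.
  by field; rewrite gt_eqF.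
rewrite lin xE ltr_pM2l //.
have le1 : 1 + r * (Num.sg m * x / `|m| - 1) <= 1 + r * (`|x| / `|m| - 1).
  by rewrite lerD2l ler_pM2l // lerD2r ler_pM2r ?invr_gt0.
(* If |x| = |m| then x = -m. Bernoulli is then an equality, and strictness comes from the sign of
   [x]. *)
have [x1|x1] := eqVneq (`|x| / `|m|) 1; last first.
  by apply: le_lt_trans le1 (bern _ _ x1); rewrite divr_ge0.
rewrite x1 powR1 gtrDl pmulr_rlt0 // subr_lt0 ltr_pdivrMr // mul1r.
have {x1} xm1 : `|x| = `|m| by rewrite -[LHS](divfK (lt0r_neq0 M0)) x1 mul1r.
rewrite -xm1 lt_neqAle sx andbT; apply: contraNneq xm => sE.
have /eqP : Num.sg m * x = Num.sg m * m by rewrite sE mE.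
by rewrite (inj_eq (mulfI _)) // sgr_eq0.
Qed.

(** The tangent inequality at [t j], weighted by row j, loses its linear term because [t j] is the
    weighted mean. The column sums make the total of the gaps [e] the difference of the two power
    sums, so equality forces each gap to vanish. *)
Lemma doubly_stochastic_powR (n : nat) (J : 'I_n -> 'I_n -> R) (s t : 'I_n -> R) (r : R) :
    1 < r -> (forall j i, 0 <= J j i) -> (forall j, \sum_i J j i = 1) ->
    (forall i, \sum_j J j i = 1) -> (forall j, t j = \sum_i J j i * s i) ->
  \sum_j `|t j| `^ r <= \sum_i `|s i| `^ r /\
  (\sum_j `|t j| `^ r = \sum_i `|s i| `^ r -> forall j i, 0 < J j i -> s i = t j).
Proof.
move=> r1 J0 Jr Jc tE.
have [k hk] := choice (fun m => powR_tangent m r1).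
pose e j i := J j i * (`|s i| `^ r - `|t j| `^ r - k (t j) * (s i - t j)).
have gap j i : s i != t j -> 0 < `|s i| `^ r - `|t j| `^ r - k (t j) * (s i - t j).
  by move=> /hk; rewrite -addrA -opprD subr_gt0.
have e0 j i : 0 <= e j i.
  rewrite mulr_ge0 //; have [->|/gap/ltW//] := eqVneq (s i) (t j).
  by rewrite !subrr mulr0 subrr.
have eE : \sum_j \sum_i e j i = \sum_i `|s i| `^ r - \sum_j `|t j| `^ r.
  transitivity (\sum_j (\sum_i J j i * `|s i| `^ r - `|t j| `^ r)).
    apply: eq_bigr => j _.
    transitivity (\sum_i (J j i * `|s i| `^ r - (J j i * `|t j| `^ r + (k (t j) * (J j i * s i) - k (t j) * t j * J j i)))).
      by apply: eq_bigr => i _; rewrite /e; ring.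
    rewrite sumrB big_split /= sumrB -mulr_suml -!mulr_sumr Jr -tE.
    by rewrite mul1r mulr1 subrr addr0.
  rewrite sumrB; congr (_ - _); rewrite exchange_big /=; apply: eq_bigr => i _.
  by rewrite -mulr_suml Jc mul1r.
split=> [|eq_sum j i Jji].
  by rewrite -subr_ge0 -eE; apply: sumr_ge0 => j _; apply: sumr_ge0.
rewrite eq_sum subrr in eE.
have ej : \sum_i e j i = 0.
  by apply: (psumr_eq0P _ eE) => // l _; apply: sumr_ge0.
have /eqP : e j i = 0 by apply: (psumr_eq0P _ ej).
rewrite mulf_eq0 gt_eqF //= => /eqP ez; apply/eqP/negPn/negP => /gap.
by rewrite ez ltxx.
Qed.

(** * Cofactors, Lagrange interpolation and scores *)

Definition root_cofactor (n : nat) (a : 'rV[R]_n) (i : 'I_n) : {poly R} :=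
  \prod_(k < n | k != i) ('X - (a 0 k)%:P).

Section Cofactors.
Variables (n : nat) (a : 'rV[R]_n).
Let f := rootpoly a.

Lemma rootpolyE i : f = ('X - (a 0 i)%:P) * root_cofactor a i.
Proof. by rewrite /f /rootpoly (bigD1 i). Qed.

Lemma size_rootpoly : size f = n.+1.
Proof. by rewrite /f /rootpoly size_prod_XsubC /index_enum -enumT size_enum_ord. Qed.

Lemma coef_rootpoly : f`_n = 1.
Proof.
have : lead_coef f = 1 by rewrite /f /rootpoly lead_coef_prod_XsubC.
by rewrite /lead_coef size_rootpoly.
Qed.

Lemma monic_cofactor i : root_cofactor a i \is monic.
Proof. exact: monic_prod_XsubC. Qed.

Lemma size_cofactor i : size (root_cofactor a i) = n.
Proof.
have := size_rootpoly; rewrite (rootpolyE i) (size_monicM (monicXsubC _)).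
  by rewrite size_XsubC => -[].
by rewrite monic_neq0 // monic_cofactor.
Qed.

Lemma coef_cofactor i : (root_cofactor a i)`_n.-1 = 1.
Proof. by have /eqP := monic_cofactor i; rewrite /lead_coef size_cofactor. Qed.

Lemma horner_cofactor_neq i j : j != i -> (root_cofactor a i).[a 0 j] = 0.
Proof. by move=> ji; rewrite /root_cofactor (bigD1 j) //= hornerM hornerXsubC subrr mul0r. Qed.

Lemma root_rootpoly i : root f (a 0 i).
Proof. by rewrite (rootpolyE i) rootM root_XsubC eqxx. Qed.

Lemma deriv_rootpoly i : f^`().[a 0 i] = (root_cofactor a i).[a 0 i].
Proof. by rewrite (rootpolyE i) derivM derivXsubC mul1r hornerD hornerM hornerXsubC subrr mul0r addr0. Qed.

Lemma deriv2_rootpoly i : f^`()^`().[a 0 i] = 2 * (root_cofactor a i)^`().[a 0 i].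
Proof. by rewrite (rootpolyE i) deriv2_mulXsubC hornerD hornerZ hornerM hornerXsubC subrr mul0r addr0. Qed.

Hypothesis a_inj : injective (fun i => a 0 i).

Lemma horner_cofactor_eq i : (root_cofactor a i).[a 0 i] != 0.
Proof.
rewrite /root_cofactor horner_prod; apply/prodf_neq0 => k ki.
by rewrite hornerXsubC subr_eq0 (inj_eq a_inj) eq_sym.
Qed.

Lemma poly_eq_at_roots p q : (size p <= n)%N -> (size q <= n)%N ->
  (forall i, p.[a 0 i] = q.[a 0 i]) -> p = q.
Proof.
move=> sp sq pq; apply/eqP; rewrite -subr_eq0; apply/eqP.
apply: (@roots_geq_poly_eq0 _ _ [seq a 0 i | i <- enum 'I_n]).
- by apply/allP => _ /mapP[i _ ->]; rewrite /root hornerD hornerN pq subrr.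
- by rewrite map_inj_uniq // enum_uniq.
- by rewrite size_map size_enum_ord (leq_trans (size_polyD _ _)) // geq_max size_polyN sp.
Qed.

Lemma lagrange_cofactor p : (size p <= n)%N ->
  p = \sum_i (p.[a 0 i] / (root_cofactor a i).[a 0 i]) *: root_cofactor a i.
Proof.
move=> sp; apply: poly_eq_at_roots => // [|j].
  apply: leq_trans (size_sum _ _ _) _; apply/bigmax_leqP => i _.
  by rewrite (leq_trans (size_scale_leq _ _)) // size_cofactor.
rewrite horner_sum (bigD1 j) //= big1 => [|i ij].
  by rewrite hornerZ addr0 divfK // horner_cofactor_eq.
by rewrite hornerZ (@horner_cofactor_neq i j) ?mulr0 // eq_sym.
Qed.

Lemma lagrange_coef p : (size p <= n)%N ->
  p`_n.-1 = \sum_i p.[a 0 i] / (root_cofactor a i).[a 0 i].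
Proof.
move=> /lagrange_cofactor {1}->; rewrite coef_sum; apply: eq_bigr => i _.
by rewrite coefZ coef_cofactor mulr1.
Qed.

(** The score is the logarithmic derivative of the cofactor at its own root. *)
Lemma scoreE i : score a 0 i = (root_cofactor a i)^`().[a 0 i] / (root_cofactor a i).[a 0 i].
Proof.
rewrite mxE; apply/eqP; rewrite eq_sym -(inj_eq (mulIf (horner_cofactor_eq i))) divfK ?horner_cofactor_eq //.
rewrite mulrC; apply/eqP; rewrite /root_cofactor.
elim/big_rec2: _ => [|k q s ki IH]; first by rewrite derivC horner0 mulr0.
rewrite derivM derivXsubC mul1r hornerD !hornerM hornerXsubC IH.
have : a 0 i - a 0 k != 0 by rewrite subr_eq0 (inj_eq a_inj) eq_sym.
by move=> ak; field.
Qed.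

Lemma deriv_rootpoly_sum : f^`() = \sum_i root_cofactor a i.
Proof.
rewrite [LHS]lagrange_cofactor; last by rewrite size_deriv size_rootpoly.
by apply: eq_bigr => i _; rewrite deriv_rootpoly divff ?horner_cofactor_eq // scale1r.
Qed.

(** Lagrange interpolation of f'', whose value at [a 0 i] is twice the derivative of the cofactor
    there. *)
Lemma deriv2_rootpoly_sum : f^`()^`() = \sum_i (2 * score a 0 i) *: root_cofactor a i.
Proof.
rewrite [LHS]lagrange_cofactor; last by rewrite !size_deriv size_rootpoly /= leq_pred.
by apply: eq_bigr => i _; rewrite deriv2_rootpoly scoreE mulrA.
Qed.

Lemma simple_real_rootpoly : simple_real n f.
Proof.
split; first by rewrite size_rootpoly leqnn andbT leqnSn.
exists [seq a 0 i | i <- enum 'I_n]; split.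
- by rewrite map_inj_uniq // enum_uniq.
- by apply/allP => _ /mapP[i _ ->]; apply: root_rootpoly.
- by rewrite size_map size_enum_ord size_rootpoly.
Qed.

End Cofactors.

End RootPolynomials.

(** * Root vectors, transfer of scores and the equality case *)

Section Scores.
Set Implicit Arguments.
Unset Strict Implicit.
Variable R : realType.
Implicit Types (u v w p q f g h : {poly R}) (x y z : R).

Lemma rootpoly_seq n (a : 'rV[R]_n) :
  rootpoly a = \prod_(x <- [seq a 0 i | i <- enum 'I_n]) ('X - x%:P).
Proof. by rewrite big_map big_enum. Qed.

Lemma coef_pred_rootpoly n (a : 'rV[R]_n) : (0 < n)%N ->
  (rootpoly a)`_n.-1 = - \sum_i a 0 i.
Proof.
move=> n0; have := @coefPn_prod_XsubC R [seq a 0 i | i <- enum 'I_n].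
by rewrite -rootpoly_seq size_map size_enum_ord big_map big_enum -lt0n => ->.
Qed.

Lemma simple_real_ffop_rootpoly n (a b : 'rV[R]_n) : injective (fun i => a 0 i) ->
  simple_real n (ffop n (rootpoly b) (rootpoly a)).
Proof.
move=> /simple_real_rootpoly Fa; rewrite [rootpoly b]rootpoly_seq.
have := @simple_real_ffop R [seq b 0 i | i <- enum 'I_n] (rootpoly a).
by rewrite size_map size_enum_ord; apply.
Qed.

Lemma simple_real_rootpoly_inj n (a : 'rV[R]_n) : simple_real n (rootpoly a) ->
  injective (fun i => a 0 i).
Proof.
move=> Fa i j aij; apply/eqP/negPn/negP => ij.
have := simple_real_deriv Fa (root_rootpoly a i); rewrite deriv_rootpoly.
by rewrite aij (@horner_cofactor_neq _ _ a i j) ?eqxx // eq_sym.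
Qed.

Lemma exists_sorted_roots n p : p \is monic -> size p = n.+1 -> simple_real n p ->
  exists g : 'rV[R]_n, nondecreasing_vec g /\ rootpoly g = p.
Proof.
move=> mp sp [_ [s0 [us0 rs0 ss0]]].
pose s := sort <=%O s0.
have ss : size s = n by rewrite size_sort; move: ss0; rewrite sp => -[].
have us : uniq s by rewrite sort_uniq.
have rs : all (root p) s by rewrite all_sort.
exists (\row_i s`_i); split.
  move=> i j ij; rewrite !mxE.
  apply: (sorted_leq_nth le_trans le_refl 0 (sort_le_sorted s0)) => //;
    by rewrite inE -/s ss ltn_ord.
have -> : p = \prod_(x <- s) ('X - x%:P).
  have := all_roots_prod_XsubC (etrans sp (esym (congr1 S ss))) rs.
  by rewrite uniq_rootsE us (monicP mp) scale1r => ->.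
rewrite (big_nth 0) ss big_mkord /rootpoly.
by apply: eq_bigr => i _; rewrite mxE.
Qed.

Lemma exists_score_gt0 n (a : 'rV[R]_n) : (1 < n)%N -> injective (fun i => a 0 i) ->
  exists i, 0 < score a 0 i.
Proof.
move=> n1 a_inj; have n0 : (0 < n)%N by apply: ltnW.
have [i hi] : exists i, forall k, a 0 k <= a 0 i.
  by exists [arg max_(i > Ordinal n0) a 0 i]%O; case: arg_maxP => // i _ h k; apply: h.
exists i; rewrite mxE.
have [j ji] : exists j, j != i.
  by have [E|] := eqVneq (Ordinal n0) i; [exists (Ordinal n1); rewrite -E|exists (Ordinal n0)].
have pos k : k != i -> 0 < (a 0 i - a 0 k)^-1.
  by move=> ki; rewrite invr_gt0 subr_gt0 lt_neqAle hi (inj_eq a_inj) ki.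
rewrite (bigD1 j) //= ltr_pwDl ?pos //.
by apply: sumr_ge0 => k /andP[ki _]; rewrite ltW ?pos.
Qed.

(** The score is positive at the largest coordinate. Applied to [- a], this makes it negative at the
    smallest one. *)
Lemma score_not_constant n (a : 'rV[R]_n) c : (1 < n)%N -> injective (fun i => a 0 i) ->
  ~ (forall i, score a 0 i = c).
Proof.
move=> n1 a_inj sc.
have [i] := exists_score_gt0 n1 a_inj.
have [|j] := @exists_score_gt0 n (- a) n1.
  by move=> k l; rewrite !mxE => /oppr_inj/a_inj.
have -> : score (- a) 0 j = - score a 0 j.
  rewrite !mxE -sumrN; apply: eq_bigr => k _.
  by rewrite !mxE -invrN; congr (_^-1); ring.
by rewrite !sc oppr_gt0 => c0 /(lt_trans c0); rewrite ltxx.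
Qed.

(** Otherwise every root equals the mean, and the product is a power. *)
Lemma not_point_mass n (b : 'rV[R]_n) : (0 < n)%N -> ~ point_mass n (rootpoly b) ->
  exists k, n%:R * b 0 k != \sum_i b 0 i.
Proof.
move=> n0 npm; apply: contrapT => nex; apply: npm.
have n0' : n%:R != 0 :> R by rewrite pnatr_eq0 -lt0n.
exists ((\sum_i b 0 i) / n%:R); rewrite /rootpoly.
rewrite (eq_bigr (fun=> 'X - ((\sum_i b 0 i) / n%:R)%:P)) ?prodr_const ?card_ord // => k _.
have /eqP kE : n%:R * b 0 k == \sum_i b 0 i by apply: contrapT => /negP h; apply: nex; exists k.
by rewrite -kE mulrAC divff ?mul1r.
Qed.

Section Transfer.
Variables (n : nat) (a b g : 'rV[R]_n).
Hypotheses (n1 : (1 < n)%N) (a_inj : injective (fun i => a 0 i)).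
Let T := ffop n (rootpoly b).
Hypothesis gE : rootpoly g = T (rootpoly a).

Let g_inj : injective (fun i => g 0 i).
Proof. by apply: simple_real_rootpoly_inj; rewrite gE; apply: simple_real_ffop_rootpoly. Qed.

Let n0 : (0 < n)%N. Proof. exact: ltnW. Qed.

Lemma sum_roots_ffop : \sum_j g 0 j = \sum_i a 0 i + \sum_i b 0 i.
Proof.
have := coef_pred_rootpoly g n0; rewrite gE /T.
move: (coef_rootpoly a) (coef_rootpoly b) (size_rootpoly a).
move: (coef_pred_rootpoly a n0) (coef_pred_rootpoly b n0).
case: (n) n0 (rootpoly a) (rootpoly b) (\sum_i a 0 i) (\sum_i b 0 i) (\sum_i g 0 i) => // m _ f q A B G /= fA qB f1 q1 sf.
rewrite coef_pred_ffop ?sf // fA qB -opprD => /oppr_inj.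
by [].
Qed.

(* The Jacobian of the roots [g] with respect to the roots [a]. *)
Let J j i := (T (root_cofactor a i)).[g 0 j] / (root_cofactor g j).[g 0 j].

Let sizeT p : size (T p) = size p.
Proof. by rewrite size_ffop // coef_rootpoly. Qed.

Lemma jacobian_row j : \sum_i J j i = 1.
Proof.
have E : \sum_i T (root_cofactor a i) = (rootpoly g)^`().
  by rewrite gE /T deriv_ffop deriv_rootpoly_sum // raddf_sum.
rewrite -mulr_suml -horner_sum E.
by rewrite deriv_rootpoly divff // horner_cofactor_eq.
Qed.

Lemma jacobian_col i : \sum_j J j i = 1.
Proof.
have sc : (size (root_cofactor a i) <= n.-1.+1)%N by rewrite prednK // size_cofactor.
rewrite -lagrange_coef // ?sizeT ?size_cofactor //.
by have [_ ->] := size_coef_ffop (coef_rootpoly b) sc; rewrite coef_cofactor.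
Qed.

Lemma jacobian_score j : score g 0 j = \sum_i J j i * score a 0 i.
Proof.
have two : 2 != 0 :> R by rewrite pnatr_eq0.
have c0 := horner_cofactor_eq g_inj j.
apply: (mulfI two); apply: (mulIf c0).
rewrite scoreE // mulrA divfK // -deriv2_rootpoly gE /T !deriv_ffop deriv2_rootpoly_sum //.
rewrite raddf_sum horner_sum -/T mulrAC mulr_sumr; apply: eq_bigr => i _.
by rewrite /= /T linearZ hornerZ -/T /J; field.
Qed.

Lemma jacobian_ge0 j i : 0 <= J j i.
Proof.
have := @ffop_derivative_ge0 R [seq b 0 i | i <- enum 'I_n] (rootpoly a) (root_cofactor a i) (a 0 i) (g 0 j).
rewrite size_map size_enum_ord /= -rootpoly_seq -/T -gE.
move=> /(_ (simple_real_rootpoly a_inj) n1 (rootpolyE a i) (size_cofactor a i) (root_rootpoly g j)).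
rewrite deriv_rootpoly; have := horner_cofactor_eq g_inj j.
rewrite /J; move: (T _).[_] (_.[_]) => x y y0 xy.
have -> : x / y = (y * x) / y ^+ 2 by field.
by rewrite divr_ge0 // sqr_ge0.
Qed.

Lemma jacobian_gt0 j k i : (forall l, g 0 j - b 0 k != a 0 l) -> 0 < J j i.
Proof.
move=> hj; rewrite lt_neqAle jacobian_ge0 andbT eq_sym mulf_neq0 ?invr_eq0 ?horner_cofactor_eq //.
(* The factor of [b 0 k] is the one peeled off. By hypothesis [g 0 j - b 0 k] is not a root of
   [rootpoly a], hence of none of its cofactors. *)
pose s := [seq b 0 l | l <- enum 'I_n & l != k].
have sE : (size s).+1 = n.
  have := count_predC (pred1 k) (enum 'I_n).
  by rewrite count_uniq_mem ?enum_uniq // mem_enum size_enum_ord size_map size_filter.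
have bE : \prod_(x <- s) ('X - x%:P) = root_cofactor b k by rewrite big_map big_filter big_enum_cond.
have := @ffop_cofactor_neq0 R s (b 0 k) (rootpoly a) (root_cofactor a i) (a 0 i) (g 0 j).
rewrite /= sE bE -(rootpolyE b k) -/T -gE; apply.
- by rewrite -ltnS sE.
- exact: simple_real_rootpoly.
- exact: rootpolyE.
- exact: size_cofactor.
- rewrite /root_cofactor horner_prod; apply/prodf_neq0 => l _.
  by rewrite hornerXsubC subr_eq0.
- exact: root_rootpoly.
Qed.

Lemma score_powR_le r : 1 < r ->
  \sum_j `|score g 0 j| `^ r <= \sum_i `|score a 0 i| `^ r /\
  (\sum_j `|score g 0 j| `^ r = \sum_i `|score a 0 i| `^ r -> point_mass n (rootpoly b)).
Proof.
move=> r1.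
have [le eq] := doubly_stochastic_powR r1 jacobian_ge0 jacobian_row jacobian_col jacobian_score.
split=> // /eq Jeq; apply: contrapT => /(not_point_mass n0)[k hk].
have [j hj] : exists j, forall l, g 0 j - b 0 k != a 0 l.
  apply: contrapT => nex.
  have /choice[sg sgE] j : exists l, g 0 j - b 0 k = a 0 l.
    apply: contrapT => nl; apply: nex; exists j => l.
    by apply/eqP => E; apply: nl; exists l.
  have sg_inj : injective sg.
    by move=> x y xy; have := sgE x; rewrite xy -sgE => /addIr/g_inj.
  (* Summing over the permutation [sg] and using additivity of root sums makes [b 0 k] the mean of
     [b], against the choice of [k]. *)
  have : \sum_j (g 0 j - b 0 k) = \sum_i a 0 i.
    by rewrite [RHS](reindex_inj sg_inj); apply: eq_bigr => j _; rewrite sgE.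
  rewrite sumrB sum_roots_ffop sumr_const card_ord -mulr_natl => E.
  case/eqP: hk; apply/eqP; rewrite -subr_eq0 -oppr_eq0 opprB -(inj_eq (addrI (\sum_i a 0 i))).
  by rewrite addrA E addr0.
apply: (@score_not_constant n a (score g 0 j) n1 a_inj) => i.
exact: Jeq (jacobian_gt0 _ hj).
Qed.

End Transfer.

End Scores.

Theorem theorem5p2 (R : realType) (n : nat) (hn : (2 <= n)%N)
    (alpha beta : 'rV[R]_n) (halpha : injective (fun i : 'I_n => alpha ord0 i))
    (p : R) (hp : 1 < p) :
  lpnorm p (score (Omega alpha beta)) <= lpnorm p (score alpha) /\
  (lpnorm p (score (Omega alpha beta)) = lpnorm p (score alpha) <->
   point_mass n (rootpoly beta)).
Proof.
have Fr := simple_real_ffop_rootpoly beta halpha.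
have sr : size (ffop n (rootpoly beta) (rootpoly alpha)) = n.+1.
  by rewrite size_ffop ?coef_rootpoly ?size_rootpoly.
have mr : ffop n (rootpoly beta) (rootpoly alpha) \is monic.
  have [_ c] := size_coef_ffop (coef_rootpoly beta) (eq_leq (size_rootpoly alpha)).
  by rewrite monicE /lead_coef sr c coef_rootpoly.
have [g [gs gE]] := exists_sorted_roots mr sr Fr.
(* A sorted root vector exists, so the default value of [ordered_roots] is not taken. *)
have -> : Omega alpha beta = g.
  by rewrite /Omega ffconvE ?size_rootpoly // -gE ordered_rootsE.
have [le eq] := score_powR_le hn halpha gE hp.
have p0 : 0 < p^-1 by rewrite invr_gt0 (lt_trans ltr01).
have nn (v : 'rV[R]_n) : \sum_i `|v 0 i| `^ p \in Num.nneg.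
  by rewrite nnegrE; apply: sumr_ge0 => i _; apply: powR_ge0.
split; first by apply: ge0_ler_powR; rewrite ?nn ?(ltW p0).
split=> [/(powR_injective p0 (nn _) (nn _))//|[b bE]].
rewrite /lpnorm; congr (_ `^ _); apply/eqP; rewrite eq_le le /=.
have g_inj : injective (fun i => g 0 i) by apply: simple_real_rootpoly_inj; rewrite gE.
(* For a point mass at [b], convolving back with the point mass at [- b] recovers [alpha] from [g],
   and the inequality already proved gives the reverse one. *)
have aE : rootpoly alpha = ffop n (rootpoly (const_mx (- b) : 'rV_n)) (rootpoly g).
  have -> : rootpoly (const_mx (- b) : 'rV_n) = ('X - (- b)%:P) ^+ n.
    by rewrite /rootpoly -[in RHS](card_ord n) -prodr_const; apply: eq_bigr => i _; rewrite mxE.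
  rewrite ffop_XsubC_exp ?size_rootpoly // gE bE ffop_XsubC_exp ?size_rootpoly //.
  by rewrite -comp_polyA comp_polyB comp_polyX comp_polyC polyCN opprK addrK comp_polyXr.
by have [] := score_powR_le hn g_inj aE hp.
Qed.
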